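(* Let $A$ and $B$ be Archimedean semiprime $f$-algebras. Then the Riesz tensor product $A\overline{\otimes}B$ can be endowed with an $f$-algebra product which extends the canonical multiplication of the algebraic tensor product $A\otimes B$. In addition, $A\overline{\otimes}B$ satisfies the following multiplicative universal property: for every Archimedean $f$-algebra $C$ and every multiplicative Riesz bimorphism $\psi:A\times B\to C$, there exists a unique map $\psi^{\otimes}:A\overline{\otimes}B\to C$ which is both an algebra homomorphism and a Riesz homomorphism and satisfies $$\psi^{\otimes}(f\otimes g)=\psi(f,g)\quad\text{for all } f\in A,\ g\in B .$$
   Context: A Riesz space is a real vector lattice. A lattice-ordered algebra is a Riesz space with an associative bilinear multiplication for which products of positive elements are positive; it is an $f$-algebra if $f\wedge g=0$ and $h\ge 0$ imply $fh\wedge g=hf\wedge g=0$. No unit element is assumed. An $f$-algebra is semiprime if it has no nonzero nilpotent elements. A Riesz homomorphism is a linear map $T$ with $T(|x|)=|T(x)|$. A bilinear map $\varphi:E\times F\to G$ between Riesz spaces is a Riesz bimorphism if $\varphi(\cdot,y)$ and $\varphi(x,\cdot)$ are Riesz homomorphisms for all $x\in E^{+}$, $y\in F^{+}$. A bilinear map $\psi:A\times B\to C$ between algebras is multiplicative if $\psi(aa',bb')=\psi(a,b)\psi(a',b')$ for all $a,a'\in A$, $b,b'\in B$. Algebra homomorphisms are linear multiplicative maps. Riesz (Fremlin) tensor product: for Archimedean Riesz spaces $E,F$, $E\overline{\otimes}F$ is the (essentially unique) Archimedean Riesz space with a Riesz bimorphism $\otimes:E\times F\to E\overline{\otimes}F$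 such that for every Archimedean Riesz space $G$ and every Riesz bimorphism $\varphi:E\times F\to G$ there is a unique Riesz homomorphism $\varphi^{\otimes}:E\overline{\otimes}F\to G$ with $\varphi^{\otimes}(x\otimes y)=\varphi(x,y)$. The algebraic tensor product $E\otimes F$ is identified with the linear span of $\{x\otimes y\}$ in $E\overline{\otimes}F$, and $E\overline{\otimes}F$ is the Riesz subspace generated by $E\otimes F$. The canonical multiplication on $A\otimes B$ is the bilinear one determined by $(a\otimes b)\cdot(a'\otimes b')=aa'\otimes bb'$. *)

(* Defs.v *)
From HB Require Import structures.
From mathcomp Require Import all_boot all_order all_algebra.
From mathcomp Require Import reals.

Set Implicit Arguments.
Unset Strict Implicit.
Unset Printing Implicit Defensive.

Import Order.TTheory GRing.Theory Num.Theory.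

Local Open Scope ring_scope.

(* A Riesz space is built on [Num.POrderedZmodule], which only puts an order
   and an additive group on the same carrier, and [riesz_meet] and [riesz_join]
   are the binary infima and suprema of that order. They are not obtained from
   [Order.Lattice]: Hierarchy Builder rejects a second structure joining
   [Order.Lattice] and [GRing.Zmodule] besides [Num.RealDomain]. *)
HB.mixin Record Lmodule_isRiesz (R : realType) V
    of GRing.Lmodule R V & Num.POrderedZmodule V := {
  riesz_meet : V -> V -> V;
  riesz_join : V -> V -> V;
  riesz_lerD2r : forall x y z : V, x <= y -> x + z <= y + z;
  riesz_scale_ge0 : forall (a : R) (x : V), 0 <= a -> 0 <= x -> 0 <= a *: x;
  riesz_lexI : forall x y z : V,
    (x <= riesz_meet y z) = (x <= y) && (x <= z);
  riesz_leUx : forall x y z : V,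
    (riesz_join x y <= z) = (x <= z) && (y <= z)
}.

#[short(type="rieszType")]
HB.structure Definition Riesz (R : realType) :=
  { V of Lmodule_isRiesz R V & GRing.Lmodule R V & Num.POrderedZmodule V }.

Definition riesz_abs (R : realType) (V : rieszType R) (x : V) : V :=
  riesz_join x (- x).

Definition archimedean (R : realType) (V : rieszType R) : Prop :=
  forall x y : V, 0 <= x -> (forall n : nat, x *+ n <= y) -> x = 0.

Definition riesz_hom (R : realType) (V W : rieszType R) (T : V -> W) : Prop :=
  linear T /\ forall x : V, T (riesz_abs x) = riesz_abs (T x).

Definition bilinear_map (R : realType) (E F G : lmodType R)
    (phi : E -> F -> G) : Prop :=
  (forall y : F, linear (phi^~ y)) /\ (forall x : E, linear (phi x)).

Definition riesz_bimorphism (R : realType) (E F G : rieszType R)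
    (phi : E -> F -> G) : Prop :=
  [/\ bilinear_map phi,
      forall y : F, 0 <= y -> riesz_hom (fun x : E => phi x y)
    & forall x : E, 0 <= x -> riesz_hom (phi x)].

(* The multiplication is a parameter rather than part of a ring structure on
   [V]: it need not have a unit. *)
Record lattice_ordered_algebra (R : realType) (V : rieszType R)
    (mul : V -> V -> V) : Prop := LatticeOrderedAlgebra {
  loa_assoc : associative mul;
  loa_bilinear : bilinear_map mul;
  loa_mul_ge0 : forall f g : V, 0 <= f -> 0 <= g -> 0 <= mul f g
}.

Record f_algebra (R : realType) (V : rieszType R)
    (mul : V -> V -> V) : Prop := FAlgebra {
  falg_loa : lattice_ordered_algebra mul;
  falg_disjoint : forall f g h : V, riesz_meet f g = 0 -> 0 <= h ->
    riesz_meet (mul f h) g = 0 /\ riesz_meet (mul h f) g = 0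
}.

(* [iter n (mul x) x] is the power of [x] with exponent [n + 1]. *)
Definition nilpotent (R : realType) (V : rieszType R) (mul : V -> V -> V)
    (x : V) : Prop :=
  exists n : nat, iter n (mul x) x = 0.

Definition semiprime (R : realType) (V : rieszType R)
    (mul : V -> V -> V) : Prop :=
  forall x : V, nilpotent mul x -> x = 0.

Definition multiplicative (V W : Type) (mulV : V -> V -> V)
    (mulW : W -> W -> W) (T : V -> W) : Prop :=
  forall x y : V, T (mulV x y) = mulW (T x) (T y).

Definition algebra_hom (R : realType) (V W : rieszType R)
    (mulV : V -> V -> V) (mulW : W -> W -> W) (T : V -> W) : Prop :=
  linear T /\ multiplicative mulV mulW T.

Definition bimultiplicative (A B C : Type) (mulA : A -> A -> A)
    (mulB : B -> B -> B) (mulC : C -> C -> C) (psi : A -> B -> C) : Prop :=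
  forall (a a' : A) (b b' : B),
    psi (mulA a a') (mulB b b') = mulC (psi a b) (psi a' b').

(* [T] with the map [tens] is a Fremlin tensor product of [E] and [F]; such a
   pair is unique up to a unique Riesz isomorphism. *)
Record riesz_tensor_product (R : realType) (E F T : rieszType R)
    (tens : E -> F -> T) : Prop := RieszTensorProduct {
  rtp_archimedean : archimedean T;
  rtp_bimorphism : riesz_bimorphism tens;
  rtp_universal : forall (G : rieszType R) (phi : E -> F -> G),
    archimedean G -> riesz_bimorphism phi ->
    exists! phiT : T -> G,
      riesz_hom phiT /\ forall (x : E) (y : F), phiT (tens x y) = phi x y
}.

(* The elements of the algebraic tensor product, seen as the linear span of
   the range of [tens], are the finite sums of elementary tensors (scalars are
   absorbed by either factor); the right-hand side is the canonical product of
   two such sums. *)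
Definition extends_canonical_product (R : realType) (A B T : rieszType R)
    (mulA : A -> A -> A) (mulB : B -> B -> B) (tens : A -> B -> T)
    (mulT : T -> T -> T) : Prop :=
  forall s s' : seq (A * B),
    mulT (\sum_(p <- s) tens p.1 p.2) (\sum_(q <- s') tens q.1 q.2) =
    \sum_(p <- s) \sum_(q <- s') tens (mulA p.1 q.1) (mulB p.2 q.2).

(* Main.v *)
Require Import Defs.
From HB Require Import structures.
From mathcomp Require Import all_boot all_order all_algebra.
From mathcomp Require Import boolp classical_sets reals lra ring.

Set Implicit Arguments.
Unset Strict Implicit.
Unset Printing Implicit Defensive.

Import Order.TTheory GRing.Theory Num.Theory.

Local Open Scope ring_scope.

(* A real Riesz homomorphism on a principal ideal of an Archimedean Riesz space [G]
   turns a Riesz bimorphism into a real one, which is a product of two real Riesz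
   homomorphisms; such real homomorphisms separate the points of the ideal. It
   follows that if [f1], [f2], [f3] are Riesz homomorphisms from the tensor product
   [T] into [G] and [f3 = f1 + f2] on positive elementary tensors, then
   [f3 = f1 + f2] on [T] (on such a principal ideal, [f1] and [f2] become
   multiples of [f3]).

   For [a, b >= 0] the Riesz bimorphism [(x, y) |-> ax (x) by] induces a Riesz
   homomorphism [M a b] of [T], which by this additivity principle depends
   bilinearly on [(a, b)]. For fixed [t >= 0], [(a, b) |-> M a b t] is again a Riesz
   bimorphism because [t] is majorized by an elementary tensor; it induces
   right multiplication by [t], which is additive in [t] by the same principle.
   Finally [(x, y) |-> ax (x) by + x (x) y] is a Riesz bimorphism as well, so
   [M a b + id] is a Riesz homomorphism, which is what makes [M a b] band
   preserving and the product an f-algebra product. *)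

Local Notation meet := riesz_meet.
Local Notation join := riesz_join.
Local Notation abs := riesz_abs.

(** * Consequences of the predicate [linear] *)

Section LinearPredicate.
Variables (R : realType) (V W : lmodType R) (f : V -> W).
Hypothesis f_lin : linear f.

Lemma linear_D x y : f (x + y) = f x + f y.
Proof. by have := f_lin 1 x y; rewrite !scale1r. Qed.

Lemma linear_0 : f 0 = 0.
Proof. by apply: (addrI (f 0)); rewrite -linear_D !addr0. Qed.

Lemma linear_scale a x : f (a *: x) = a *: f x.
Proof. by have := f_lin a x 0; rewrite !addr0 linear_0 addr0. Qed.

Lemma linear_N x : f (- x) = - f x.
Proof. by rewrite -scaleN1r linear_scale scaleN1r. Qed.

Lemma linear_B x y : f (x - y) = f x - f y.
Proof. by rewrite linear_D linear_N. Qed.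

Lemma linear_bigsum I (s : seq I) (F : I -> V) :
  f (\sum_(i <- s) F i) = \sum_(i <- s) f (F i).
Proof.
elim: s => [|i s IHs]; first by rewrite !big_nil linear_0.
by rewrite !big_cons linear_D IHs.
Qed.

End LinearPredicate.

(** * Order and lattice calculus in a Riesz space *)

Section RieszTheory.
Variables (R : realType) (V : rieszType R).
Implicit Types (x y z t : V) (a : R).

Definition pos x : V := join x 0.
Definition neg x : V := join (- x) 0.

Lemma riesz_subr_ge0 x y : (0 <= y - x) = (x <= y).
Proof.
apply/idP/idP => [/(riesz_lerD2r _ _ x)|/(riesz_lerD2r _ _ (- x))].
  by rewrite add0r subrK.
by rewrite subrr.
Qed.

Lemma riesz_leD2r z x y : (x + z <= y + z) = (x <= y).
Proof. by rewrite -riesz_subr_ge0 -[LHS]riesz_subr_ge0 opprD addrACA subrr addr0. Qed.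

Lemma riesz_leD2l z x y : (z + x <= z + y) = (x <= y).
Proof. by rewrite ![z + _]addrC riesz_leD2r. Qed.

Lemma riesz_leD x y z t : x <= y -> z <= t -> x + z <= y + t.
Proof.
by move=> xy zt; apply: (@le_trans _ _ (y + z)); rewrite ?riesz_leD2r ?riesz_leD2l.
Qed.

Lemma riesz_addr_ge0 x y : 0 <= x -> 0 <= y -> 0 <= x + y.
Proof. by move=> x0 y0; rewrite -[0]addr0; apply: riesz_leD. Qed.

Lemma riesz_leN2 x y : (- x <= - y) = (y <= x).
Proof. by rewrite -[LHS]riesz_subr_ge0 opprK addrC riesz_subr_ge0. Qed.

Lemma riesz_oppr_le0 x : (- x <= 0) = (0 <= x).
Proof. by rewrite -[in LHS]oppr0 riesz_leN2. Qed.

Lemma riesz_leDl x y : 0 <= y -> x <= x + y.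
Proof. by move=> y0; rewrite -{1}[x]addr0 riesz_leD2l. Qed.

Lemma riesz_leDr x y : 0 <= y -> x <= y + x.
Proof. by move=> y0; rewrite addrC riesz_leDl. Qed.

Lemma riesz_leZ a x y : 0 <= a -> x <= y -> a *: x <= a *: y.
Proof.
by move=> a0 xy; rewrite -riesz_subr_ge0 -scalerBr riesz_scale_ge0 ?riesz_subr_ge0.
Qed.

Lemma riesz_leZl a b x : a <= b -> 0 <= x -> a *: x <= b *: x.
Proof.
by move=> ab x0; rewrite -riesz_subr_ge0 -scalerBl riesz_scale_ge0 ?subr_ge0.
Qed.

Lemma riesz_meet_lel x y : meet x y <= x.
Proof. by have := lexx (meet x y); rewrite riesz_lexI => /andP[]. Qed.

Lemma riesz_meet_ler x y : meet x y <= y.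
Proof. by have := lexx (meet x y); rewrite riesz_lexI => /andP[]. Qed.

Lemma riesz_join_lel x y : x <= join x y.
Proof. by have := lexx (join x y); rewrite riesz_leUx => /andP[]. Qed.

Lemma riesz_join_ler x y : y <= join x y.
Proof. by have := lexx (join x y); rewrite riesz_leUx => /andP[]. Qed.

Lemma riesz_le_meet x y z : x <= y -> x <= z -> x <= meet y z.
Proof. by rewrite riesz_lexI => -> ->. Qed.

Lemma riesz_join_le x y z : x <= z -> y <= z -> join x y <= z.
Proof. by rewrite riesz_leUx => -> ->. Qed.

Lemma riesz_meet_mono x y z t : x <= y -> z <= t -> meet x z <= meet y t.
Proof.
by move=> xy zt; apply: riesz_le_meet;
  [apply: le_trans xy; apply: riesz_meet_lel | apply: le_trans zt; apply: riesz_meet_ler].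
Qed.

Lemma riesz_meetC x y : meet x y = meet y x.
Proof. by apply/le_anti; rewrite !riesz_lexI !riesz_meet_lel !riesz_meet_ler. Qed.

Lemma riesz_joinC x y : join x y = join y x.
Proof. by apply/le_anti; rewrite !riesz_leUx !riesz_join_lel !riesz_join_ler. Qed.

Lemma riesz_meetA x y z : meet x (meet y z) = meet (meet x y) z.
Proof.
apply/le_anti; rewrite !riesz_lexI riesz_meet_lel riesz_meet_ler !andbT /=.
rewrite !(le_trans (riesz_meet_ler _ _) (riesz_meet_lel _ _)).
rewrite !(le_trans (riesz_meet_ler _ _) (riesz_meet_ler _ _)).
by rewrite !(le_trans (riesz_meet_lel _ _) (riesz_meet_lel _ _)) !(le_trans (riesz_meet_lel _ _) (riesz_meet_ler _ _)).
Qed.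

Lemma riesz_meet_l x y : x <= y -> meet x y = x.
Proof. by move=> xy; apply/le_anti; rewrite riesz_meet_lel riesz_le_meet. Qed.

Lemma riesz_meet_ge0 x y : 0 <= x -> 0 <= y -> 0 <= meet x y.
Proof. exact: riesz_le_meet. Qed.

Lemma riesz_meetDr x y z : meet (x + z) (y + z) = meet x y + z.
Proof.
apply/le_anti/andP; split; last by rewrite riesz_lexI !riesz_leD2r riesz_meet_lel riesz_meet_ler.
rewrite -(riesz_leD2r (- z)) addrK.
by apply: riesz_le_meet; rewrite -(riesz_leD2r z) subrK ?riesz_meet_lel ?riesz_meet_ler.
Qed.

Lemma riesz_joinDr x y z : join (x + z) (y + z) = join x y + z.
Proof.
apply/le_anti/andP; split; first by rewrite riesz_leUx !riesz_leD2r riesz_join_lel riesz_join_ler.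
rewrite -(riesz_leD2r (- z)) addrK.
by apply: riesz_join_le; rewrite -(riesz_leD2r z) subrK ?riesz_join_lel ?riesz_join_ler.
Qed.

Lemma riesz_oppr_meet x y : - meet x y = join (- x) (- y).
Proof.
apply/le_anti/andP; split; last by rewrite riesz_leUx !riesz_leN2 riesz_meet_lel riesz_meet_ler.
rewrite -riesz_leN2 opprK.
by apply: riesz_le_meet; rewrite -riesz_leN2 opprK ?riesz_join_lel ?riesz_join_ler.
Qed.

Lemma riesz_addr_meet_join x y : meet x y + join x y = x + y.
Proof.
have -> : join x y = x + y - meet x y.
  by rewrite riesz_oppr_meet addrC -riesz_joinDr addKr [x + y]addrC addKr riesz_joinC.
by rewrite addrC subrK.
Qed.

Lemma riesz_scale_meet a x y : 0 <= a -> meet (a *: x) (a *: y) = a *: meet x y.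
Proof.
rewrite le_eqVlt => /predU1P[<-|a0]; first by rewrite !scale0r riesz_meet_l.
have a'0 : a != 0 by rewrite gt_eqF.
apply/le_anti/andP; split; last first.
  by apply: riesz_le_meet; apply: riesz_leZ (ltW a0) _; rewrite ?riesz_meet_lel ?riesz_meet_ler.
have -> : meet (a *: x) (a *: y) = a *: (a^-1 *: meet (a *: x) (a *: y)).
  by rewrite scalerA divff // scale1r.
apply: riesz_leZ (ltW a0) _; apply: riesz_le_meet.
  rewrite -[leRHS]scale1r -(mulVf a'0) -scalerA.
  by apply: riesz_leZ (riesz_meet_lel _ _); rewrite invr_ge0 ltW.
rewrite -[leRHS]scale1r -(mulVf a'0) -scalerA.
by apply: riesz_leZ (riesz_meet_ler _ _); rewrite invr_ge0 ltW.
Qed.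

Lemma pos_ge0 x : 0 <= pos x. Proof. exact: riesz_join_ler. Qed.
Lemma neg_ge0 x : 0 <= neg x. Proof. exact: riesz_join_ler. Qed.
Lemma le_pos x : x <= pos x. Proof. exact: riesz_join_lel. Qed.

Lemma pos_id x : 0 <= x -> pos x = x.
Proof. by move=> x0; apply/le_anti; rewrite riesz_join_lel riesz_join_le. Qed.

Lemma neg_0 x : 0 <= x -> neg x = 0.
Proof. by move=> x0; apply/le_anti; rewrite riesz_join_ler riesz_join_le ?riesz_oppr_le0. Qed.

Lemma posBneg x : pos x - neg x = x.
Proof.
have -> : neg x = pos x - x by rewrite -riesz_joinDr subrr add0r riesz_joinC.
by rewrite opprB addrC subrK.
Qed.

Lemma posE x : pos x = x + neg x.
Proof. by rewrite -{2}(posBneg x) subrK. Qed.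

Lemma negN x : neg (- x) = pos x. Proof. by rewrite /neg opprK. Qed.
Lemma posN x : pos (- x) = neg x. Proof. by []. Qed.

Lemma meet_pos_neg x : meet (pos x) (neg x) = 0.
Proof.
rewrite posE -[X in meet _ X]add0r riesz_meetDr.
by rewrite -[meet x 0]opprK riesz_oppr_meet oppr0 addrC subrr.
Qed.

Lemma disjoint_ge0 x y : meet x y = 0 -> 0 <= x /\ 0 <= y.
Proof. by move=> xy; split; rewrite -xy ?riesz_meet_lel ?riesz_meet_ler. Qed.

Lemma disjoint_le x y x' y' : meet x y = 0 -> 0 <= x' -> 0 <= y' ->
  x' <= x -> y' <= y -> meet x' y' = 0.
Proof.
by move=> xy x0 y0 xx yy; apply/le_anti; rewrite riesz_meet_ge0 // andbT -xy riesz_meet_mono.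
Qed.

Lemma riesz_meet_leD x y z : 0 <= x -> 0 <= y -> 0 <= z ->
  meet x (y + z) <= meet x y + meet x z.
Proof.
move=> x0 y0 z0; rewrite -riesz_meetDr; apply: riesz_le_meet.
  by apply: le_trans (riesz_meet_lel _ _) _; rewrite riesz_leDl // riesz_meet_ge0.
rewrite [y + meet _ _]addrC -riesz_meetDr; apply: riesz_le_meet.
  by apply: le_trans (riesz_meet_lel _ _) _; rewrite riesz_leDl.
by rewrite addrC riesz_meet_ler.
Qed.

Lemma disjointD x y z : meet x y = 0 -> meet x z = 0 -> meet x (y + z) = 0.
Proof.
move=> xy xz; have [x0 y0] := disjoint_ge0 xy; have [_ z0] := disjoint_ge0 xz.
apply/le_anti; rewrite riesz_meet_ge0 ?riesz_addr_ge0 // andbT.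
by apply: le_trans (riesz_meet_leD x0 y0 z0) _; rewrite xy xz addr0.
Qed.

Lemma abs_ge0 x : 0 <= abs x.
Proof.
(* Adding [x <= abs x] and [- x <= abs x] bounds twice [abs x] below by 0; halving concludes. *)
have : 0 <= abs x + abs x.
  by rewrite -(subrr x); apply: riesz_leD; rewrite ?riesz_join_lel ?riesz_join_ler.
rewrite -mulr2n -scaler_nat => /(@riesz_scale_ge0 _ _ 2^-1).
by rewrite scalerA mulVf ?pnatr_eq0 // scale1r invr_ge0 ler0n; apply.
Qed.

Lemma le_abs x : x <= abs x. Proof. exact: riesz_join_lel. Qed.
Lemma leN_abs x : - x <= abs x. Proof. exact: riesz_join_ler. Qed.

Lemma abs_le x y : x <= y -> - x <= y -> abs x <= y.
Proof. exact: riesz_join_le. Qed.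

Lemma absN x : abs (- x) = abs x.
Proof. by rewrite /abs opprK riesz_joinC. Qed.

Lemma abs_id x : 0 <= x -> abs x = x.
Proof.
move=> x0; apply/le_anti; rewrite le_abs abs_le //.
by apply: (le_trans _ x0); rewrite riesz_oppr_le0.
Qed.

Lemma abs0 : abs (0 : V) = 0. Proof. exact: abs_id. Qed.

Lemma absE x : abs x = pos x + neg x.
Proof.
apply/le_anti/andP; split.
  apply: abs_le; first by rewrite posE -addrA riesz_leDl // riesz_addr_ge0 ?neg_ge0.
  by apply: le_trans (riesz_join_lel _ 0) _; rewrite riesz_leDr // pos_ge0.
have -> : pos x + neg x = join (pos x) (neg x).
  by rewrite -riesz_addr_meet_join meet_pos_neg add0r.
by do 2?apply: riesz_join_le; rewrite ?abs_ge0 ?le_abs ?leN_abs.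
Qed.

Lemma abs_disjointB x y : meet x y = 0 -> abs (x - y) = x + y.
Proof.
move=> xy.
have J : join x y = x + y by rewrite -riesz_addr_meet_join xy add0r.
rewrite absE; congr (_ + _).
  by rewrite /pos -[X in join _ X](subrr y) riesz_joinDr J addrK.
by rewrite /neg opprB -[X in join _ X](subrr x) riesz_joinDr riesz_joinC J addrC addKr.
Qed.

Lemma abs_triangle x y : abs (x + y) <= abs x + abs y.
Proof.
by apply: abs_le; rewrite ?opprD; apply: riesz_leD; rewrite ?le_abs ?leN_abs.
Qed.

Lemma abs_abs x : abs (abs x) = abs x.
Proof. exact/abs_id/abs_ge0. Qed.

Lemma abs_eq0 x : abs x = 0 -> x = 0.
Proof.
move=> x0; apply/le_anti; rewrite -[X in x <= X]x0 le_abs /=.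
by rewrite -riesz_oppr_le0 -x0 leN_abs.
Qed.

Lemma riesz_scale_join a x y : 0 <= a -> join (a *: x) (a *: y) = a *: join x y.
Proof.
move=> a0; rewrite -[join x y]opprK -{2}(opprK x) -{2}(opprK y).
rewrite -riesz_oppr_meet opprK scalerN -riesz_scale_meet // riesz_oppr_meet.
by rewrite !scalerN !opprK.
Qed.

Lemma scale_pos a x : 0 <= a -> pos (a *: x) = a *: pos x.
Proof. by move=> a0; rewrite /pos -riesz_scale_join // scaler0. Qed.

Lemma scale_neg a x : 0 <= a -> neg (a *: x) = a *: neg x.
Proof. by move=> a0; rewrite -posN -scalerN scale_pos. Qed.

Lemma scale_abs a x : abs (a *: x) = `|a| *: abs x.
Proof.
have [a0|/ltW a0] := leP 0 a; first by rewrite ger0_norm // /abs -riesz_scale_join // scalerN.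
by rewrite ler0_norm // -absN -scaleNr /abs -riesz_scale_join ?oppr_ge0 // scalerN.
Qed.

Lemma half_double x : 2^-1 *: (x + x) = x.
Proof. by rewrite -mulr2n -scaler_nat scalerA mulVf ?scale1r // pnatr_eq0. Qed.

(** Since meets are expressed by linear operations and [abs], a linear map commuting with [abs]
    preserves disjointness, and a linear subspace closed under [abs] is a Riesz subspace. *)
Lemma riesz_meetE x y : meet x y = 2^-1 *: (x + y - abs (x - y)).
Proof.
have -> : abs (x - y) = join x y - meet x y.
  have -> : abs (x - y) = (join x y - y) + (join x y - x).
    rewrite absE /pos /neg opprB; congr (_ + _); rewrite -riesz_joinDr subrr //.
    by rewrite riesz_joinC.
  by rewrite addrACA -opprD [y + x]addrC -(riesz_addr_meet_join x y) [meet x y + _]addrC addrKA.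
rewrite -(riesz_addr_meet_join x y) opprB addrACA subrr addr0 half_double //.
Qed.

End RieszTheory.

(** * Riesz homomorphisms and linear extension from the positive cone *)

Section RieszHom.
Variables (R : realType) (V W : rieszType R).
Implicit Types (f : V -> W) (x y : V).

Lemma riesz_hom_meet0 f x y : riesz_hom f -> meet x y = 0 -> meet (f x) (f y) = 0.
Proof.
case=> f_lin f_abs xy; rewrite riesz_meetE -(linear_B f_lin) -f_abs abs_disjointB //.
by rewrite -(linear_D f_lin) subrr scaler0.
Qed.

Lemma riesz_hom_ge0 f x : riesz_hom f -> 0 <= x -> 0 <= f x.
Proof. by case=> _ f_abs x0; rewrite -(abs_id x0) f_abs abs_ge0. Qed.

Lemma riesz_hom_le f x y : riesz_hom f -> x <= y -> f x <= f y.
Proof.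
move=> f_hom; rewrite -riesz_subr_ge0 => /(riesz_hom_ge0 f_hom).
by case: f_hom => f_lin _; rewrite linear_B // riesz_subr_ge0.
Qed.

(** The images of [pos x] and [neg x] are disjoint, so the absolute value of their difference [f x]
    is their sum [f (abs x)]. *)
Lemma riesz_homI f : linear f ->
  (forall x y, meet x y = 0 -> meet (f x) (f y) = 0) -> riesz_hom f.
Proof.
move=> f_lin f_disj; split=> // x.
rewrite absE (linear_D f_lin) -{3}(posBneg x) (linear_B f_lin).
by rewrite abs_disjointB // f_disj // meet_pos_neg.
Qed.

(** Kantorovich's extension: if [f] is additive and positively homogeneous on the positive cone,
    this is the linear map that agrees with it there. *)
Definition cone_ext f x : W := f (pos x) - f (neg x).

Section ConeExt.
Variable f : V -> W.
Hypothesis fD : forall x y, 0 <= x -> 0 <= y -> f (x + y) = f x + f y.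
Hypothesis fZ : forall (a : R) x, 0 <= a -> 0 <= x -> f (a *: x) = a *: f x.

(** Any decomposition into positive elements may replace [pos] and [neg]: additivity is applied to
    both sides of [pos z + y = neg z + x]. *)
Lemma cone_extB x y : 0 <= x -> 0 <= y -> cone_ext f (x - y) = f x - f y.
Proof.
move=> x0 y0; rewrite /cone_ext; set z := x - y.
have : f (pos z + y) = f (neg z + x).
  by congr f; rewrite posE {1}/z addrAC subrK addrC.
rewrite !fD ?pos_ge0 ?neg_ge0 // => E.
apply: (@addIr _ (f y)); rewrite subrK addrAC E.
by rewrite addrAC subrr add0r.
Qed.

Lemma cone_ext_linear : linear (cone_ext f).
Proof.
have eN x : cone_ext f (- x) = - cone_ext f x by rewrite /cone_ext posN negN opprB.
have eP a x : 0 <= a -> cone_ext f (a *: x) = a *: cone_ext f x.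
  by move=> a0; rewrite /cone_ext scale_pos // scale_neg // !fZ ?pos_ge0 ?neg_ge0 // scalerBr.
have eZ a x : cone_ext f (a *: x) = a *: cone_ext f x.
  have [|/ltW a0] := leP 0 a; first exact: eP.
  by rewrite -[a]opprK scaleNr eN eP ?oppr_ge0 // [RHS]scaleNr.
move=> a x y; rewrite -eZ; set x' := a *: x.
rewrite -{1}(posBneg x') -{1}(posBneg y) addrACA -opprD cone_extB; last 2 first.
- by rewrite riesz_addr_ge0 ?pos_ge0.
- by rewrite riesz_addr_ge0 ?neg_ge0.
by rewrite !fD ?pos_ge0 ?neg_ge0 // opprD addrACA.
Qed.

Lemma cone_ext_id x : 0 <= x -> cone_ext f x = f x.
Proof.
have f0 : f 0 = 0 by apply: (addrI (f 0)); rewrite -fD // !addr0.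
by move=> x0; rewrite /cone_ext pos_id // neg_0 // f0 subr0.
Qed.

End ConeExt.

End RieszHom.

(** * Induction on a Riesz tensor product *)

Definition riesz_closed (R : realType) (V : rieszType R) (P : V -> Prop) :=
  [/\ P 0, forall (a : R) x y, P x -> P y -> P (a *: x + y)
    & forall x, P x -> P (abs x)].

Section Composition.
Variables (R : realType).

Lemma riesz_hom_comp (U V W : rieszType R) (f : V -> W) (g : U -> V) :
  riesz_hom f -> riesz_hom g -> riesz_hom (fun x => f (g x)).
Proof.
move=> [f_lin f_abs] [g_lin g_abs]; split=> [a x y|x]; first by rewrite g_lin f_lin.
by rewrite g_abs f_abs.
Qed.

Lemma riesz_bimorphism_comp (E F G H : rieszType R) (f : G -> H) (phi : E -> F -> G) :
  riesz_hom f -> riesz_bimorphism phi -> riesz_bimorphism (fun x y => f (phi x y)).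
Proof.
move=> f_hom [[linl linr] homl homr]; have [f_lin _] := f_hom.
split; first split.
- by move=> y a x x'; rewrite linl f_lin.
- by move=> x a y y'; rewrite linr f_lin.
- by move=> y y0; apply: riesz_hom_comp (homl y y0).
by move=> x x0; apply: riesz_hom_comp (homr x x0).
Qed.

(** Both maps are induced by the same bimorphism, namely [f] composed with [tens], so the uniqueness
    half of the universal property applies. *)
Lemma riesz_tensor_hom_eq (E F T G : rieszType R) (tens : E -> F -> T) (f g : T -> G) :
  riesz_tensor_product tens -> archimedean G -> riesz_hom f -> riesz_hom g ->
  (forall x y, f (tens x y) = g (tens x y)) -> f = g.
Proof.
move=> tensP archG f_hom g_hom fg.
have [h [_ uniq_h]] := rtp_universal tensP archG
  (riesz_bimorphism_comp f_hom (rtp_bimorphism tensP)).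
by rewrite -(uniq_h f) // -(uniq_h g) //; split=> // x y; rewrite fg.
Qed.

End Composition.

Section RieszSubspace.
Variables (R : realType) (V : rieszType R) (P : V -> Prop).
Hypothesis clP : riesz_closed P.

Definition riesz_pred : pred V := fun x => `[< P x >].

Fact riesz_pred_submod : submod_closed riesz_pred.
Proof.
case: clP => P0 PD _; split; first exact/asboolP.
by move=> a x y /asboolP Px /asboolP Py; apply/asboolP/PD.
Qed.
HB.instance Definition _ := GRing.isSubmodClosed.Build R V riesz_pred riesz_pred_submod.

(** The Riesz subspace is made a Riesz space of its own, with the induced order, so that it can be a
    target of the universal property. *)
Record riesz_sub := RieszSub { riesz_val : V; _ : riesz_val \in riesz_pred }.
HB.instance Definition _ := [isSub for riesz_val].
HB.instance Definition _ := [Choice of riesz_sub by <:].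
HB.instance Definition _ := [SubChoice_isSubZmodule of riesz_sub by <:].
HB.instance Definition _ := [SubZmodule_isSubLmodule of riesz_sub by <:].

Definition riesz_sub_le (x y : riesz_sub) := riesz_val x <= riesz_val y.
Fact riesz_sub_le_refl : reflexive riesz_sub_le. Proof. by move=> x; apply: lexx. Qed.
Fact riesz_sub_le_anti : antisymmetric riesz_sub_le.
Proof. by move=> x y xy; apply/val_inj/le_anti. Qed.
Fact riesz_sub_le_trans : transitive riesz_sub_le.
Proof. by move=> y x z; apply: le_trans. Qed.
HB.instance Definition _ := Order.Le_isPOrder.Build ring_display riesz_sub
  riesz_sub_le_refl riesz_sub_le_anti riesz_sub_le_trans.

Fact riesz_pred_meet x y : x \in riesz_pred -> y \in riesz_pred ->
  meet x y \in riesz_pred.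
Proof.
case: clP => _ _ Pabs Px Py; rewrite riesz_meetE rpredZ // rpredB ?rpredD //.
by apply/asboolP/Pabs/asboolP; exact: (rpredB Px Py).
Qed.

Fact riesz_pred_join x y : x \in riesz_pred -> y \in riesz_pred ->
  join x y \in riesz_pred.
Proof.
by move=> Px Py; rewrite -[join x y](addKr (meet x y)) riesz_addr_meet_join addrC
  rpredB ?rpredD ?riesz_pred_meet.
Qed.

Definition riesz_sub_meet (x y : riesz_sub) : riesz_sub :=
  RieszSub (riesz_pred_meet (valP x) (valP y)).
Definition riesz_sub_join (x y : riesz_sub) : riesz_sub :=
  RieszSub (riesz_pred_join (valP x) (valP y)).

Fact riesz_sub_leD2r (x y z : riesz_sub) : x <= y -> x + z <= y + z.
Proof. exact: riesz_lerD2r. Qed.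
Fact riesz_sub_scale_ge0 (a : R) (x : riesz_sub) : 0 <= a -> 0 <= x -> 0 <= a *: x.
Proof. exact: riesz_scale_ge0. Qed.
Fact riesz_sub_lexI (x y z : riesz_sub) :
  (x <= riesz_sub_meet y z) = (x <= y) && (x <= z).
Proof. exact: riesz_lexI. Qed.
Fact riesz_sub_leUx (x y z : riesz_sub) :
  (riesz_sub_join x y <= z) = (x <= z) && (y <= z).
Proof. exact: riesz_leUx. Qed.

HB.instance Definition _ := Lmodule_isRiesz.Build R riesz_sub
  riesz_sub_leD2r riesz_sub_scale_ge0 riesz_sub_lexI riesz_sub_leUx.

Lemma riesz_val_hom : riesz_hom riesz_val.
Proof. by split=> // a x y; rewrite !(raddfD, linearZ). Qed.

Lemma riesz_sub_archimedean : archimedean V -> archimedean riesz_sub.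
Proof.
move=> archV x y x0 xy; apply: val_inj; apply: (archV _ (val y)) => [|n]; first exact: x0.
by have := xy n; rewrite -!(raddfMn).
Qed.

Section Induction.
Variables (E F : rieszType R) (tens : E -> F -> V).
Hypotheses (tensP : riesz_tensor_product tens) (Ptens : forall x y, P (tens x y)).

Let phi x y : riesz_sub := RieszSub (asboolT (Ptens x y) : tens x y \in riesz_pred).

Lemma riesz_sub_bimorphism : riesz_bimorphism phi.
Proof.
have [[linl linr] homl homr] := rtp_bimorphism tensP.
split; first split.
- by move=> y a x x'; apply: val_inj; apply: linl.
- by move=> x a y y'; apply: val_inj; apply: linr.
- move=> y y0; split=> [a x x'|x]; apply: val_inj; first exact: linl.
  exact: (homl y y0).2.
move=> x x0; split=> [a y y'|y]; apply: val_inj; first exact: linr.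
exact: (homr x x0).2.
Qed.

(* The tensors induce a Riesz homomorphism into the Riesz subspace cut out by [P];
   followed by the inclusion it fixes the tensors, hence is the identity. *)
Lemma riesz_tensor_ind t : P t.
Proof.
have archV := rtp_archimedean tensP.
have [h [[h_hom h_tens] _]] := rtp_universal tensP (riesz_sub_archimedean archV)
  riesz_sub_bimorphism.
have id_hom : riesz_hom (@id V) by split.
have := riesz_tensor_hom_eq tensP archV (riesz_hom_comp riesz_val_hom h_hom) id_hom.
move=> /(_ _)/(congr1 (fun f => f t)) <- => [|x y]; last by rewrite h_tens.
by apply/asboolP; apply: (valP (h t)).
Qed.

End Induction.

End RieszSubspace.

(** * Prime ideals *)

Section PrimeIdeal.
Variables (R : realType) (V : rieszType R).
Implicit Types (x y f v : V).

(** Both elements lie below their counterparts scaled by the common factor [1 + a], and scaling by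
    one factor preserves disjointness. *)
Lemma disjoint_scale (a : R) x y : 0 <= a -> meet x y = 0 -> meet (a *: x) y = 0.
Proof.
move=> a0 xy; have [x0 y0] := disjoint_ge0 xy.
have s0 : 0 <= 1 + a by rewrite addr_ge0.
apply: (@disjoint_le _ _ ((1 + a) *: x) ((1 + a) *: y)) => //.
- by rewrite riesz_scale_meet // xy scaler0.
- exact: riesz_scale_ge0.
- by apply: riesz_leZl => //; rewrite lerDr.
by rewrite -{1}[y]scale1r; apply: riesz_leZl => //; rewrite lerDl.
Qed.

Definition filter_base v (X : set V) :=
  forall f g, X f -> X g -> [/\ X (meet f g), 0 <= f & meet f v != 0].

(** Zorn's lemma, with maximality recorded in the form that later yields primeness. *)
Lemma maximal_filter_base v : 0 <= v -> v != 0 -> exists X : set V,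
  [/\ filter_base v X, exists f, X f &
      forall x, 0 <= x -> (forall f, X f -> meet (meet f x) v != 0) -> X x].
Proof.
move=> v0 vn0.
have [C Cfilt Ctot|X [Xbase Xmax]] := @Zorn_bigcup V (filter_base v).
  move=> f g [Y CY Yf] [Z CZ Zg].
  have [U [CU Uf Ug]] : exists U, [/\ C U, U f & U g].
    by case: (Ctot Y Z CY CZ) => sub; [exists Z | exists Y]; split=> //; apply: sub.
  have [Ufg ? ?] := Cfilt U CU f g Uf Ug.
  by split=> //; exists U.
(* An empty [X] could be enlarged to the singleton of [v]. The element [f0] serves below to place
   [x] in [Y]. *)
have [f0 Xf0] : exists f, X f.
  apply: contrapT => Xempty; apply: (Xmax [set v]%classic).
    split; last by move=> /(_ v erefl) Xv; apply: Xempty; exists v.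
    by move=> f Xf; case: Xempty; exists f.
  by move=> f g -> ->; rewrite /= riesz_meet_l.
exists X; split; [exact: Xbase | by exists f0 | move=> x x0 Xx].
(* [Y] is the filter generated by [X] and [x]; if [x] were outside [X], it would be a strictly
   larger filter base. *)
apply: contrapT => NXx; pose Y := [set y | exists2 f, X f & meet f x <= y]%classic.
have XY : (X `<=` Y)%classic by move=> f Xf; exists f => //; apply: riesz_meet_lel.
apply: (Xmax Y); first split=> // YX.
  by apply/NXx/YX; exists f0 => //; apply: riesz_meet_ler.
move=> y z [f Xf fy] [g Xg gz]; have [Xfg f_ge0 _] := Xbase f g Xf Xg.
split.
- exists (meet f g) => //; apply: riesz_le_meet.
    by apply: le_trans fy; apply: riesz_meet_mono (riesz_meet_lel _ _) _.
  by apply: le_trans gz; apply: riesz_meet_mono (riesz_meet_ler _ _) _.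
- by apply: le_trans fy; apply: riesz_meet_ge0.
apply: contra_neq (Xx f Xf) => yv.
apply: (disjoint_le yv) => //; first exact: riesz_meet_ge0.
Qed.

Record prime_ideal (P : V -> Prop) : Prop := PrimeIdeal {
  prime_ideal_D : forall x y, P x -> P y -> P (x + y);
  prime_ideal_scale : forall (a : R) x, P x -> P (a *: x);
  prime_ideal_solid : forall x y, P y -> 0 <= x -> x <= y -> P x;
  prime_ideal_disjoint : forall x y, meet x y = 0 -> P x \/ P y
}.

(** The ideal consists of the elements disjoint from [meet f v] for some [f] in a maximal filter
    base [X]. It misses [v] because no [meet f v] vanishes. *)
Lemma prime_ideal_avoiding v : 0 <= v -> v != 0 ->
  exists2 P : V -> Prop, prime_ideal P & ~ P v.
Proof.
move=> v0 vn0; have [X [Xbase [f0 Xf0] Xmax]] := maximal_filter_base v0 vn0.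
have X_ge0 f : X f -> 0 <= f by move=> Xf; have [] := Xbase f f Xf Xf.
exists (fun x => exists2 f, X f & meet (abs x) (meet f v) = 0); last first.
  case=> f Xf; rewrite abs_id // riesz_meetC riesz_meet_l ?riesz_meet_ler // => fv.
  by have [_ _] := Xbase f f Xf Xf; rewrite fv eqxx.
split=> [x y [f Xf xf] [g Xg yg]|a x [f Xf xf]|x y [f Xf yf] x0 xy|x y xy].
- exists (meet f g); first by have [] := Xbase f g Xf Xg.
  have fg0 : 0 <= meet (meet f g) v by rewrite !riesz_meet_ge0 // X_ge0.
  apply: (@disjoint_le _ _ (abs x + abs y) (meet (meet f g) v)) => //.
  + rewrite riesz_meetC; apply: disjointD; rewrite riesz_meetC.
      apply: (disjoint_le xf) => //; first exact: abs_ge0.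
      exact: riesz_meet_mono (riesz_meet_lel _ _) _.
    apply: (disjoint_le yg) => //; first exact: abs_ge0.
    exact: riesz_meet_mono (riesz_meet_ler _ _) _.
  + exact: abs_ge0.
  + exact: abs_triangle.
- by exists f => //; rewrite scale_abs disjoint_scale.
- exists f => //; rewrite (abs_id x0); apply: (disjoint_le yf) => //.
    by rewrite riesz_meet_ge0 // X_ge0.
  by apply: le_trans xy _; apply: le_abs.
have [x0 y0] := disjoint_ge0 xy; rewrite !abs_id //.
(* If [x] is in [X], then [x] itself witnesses that [y] is in the ideal; otherwise maximality
   provides an [f] in [X] with [meet f x] disjoint from [v], which witnesses this for [x]. *)
have [Xx|] := pselect (X x).
  by right; exists x; rewrite // riesz_meetA [meet y x]riesz_meetC xy riesz_meet_l.
move=> NXx; left; apply: contrapT => NPx; apply: NXx; apply: Xmax => // f Xf.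
apply/eqP => E; apply: NPx; exists f => //.
by rewrite riesz_meetA [meet x f]riesz_meetC.
Qed.

End PrimeIdeal.

(** * Real Riesz homomorphisms on principal ideals *)

Section PrincipalIdeal.
Variables (R : realType) (V : rieszType R) (e : V).
Implicit Types (x y : V) (a : R).

Definition principal_ideal x : Prop := exists2 C : R, 0 <= C & abs x <= C *: e.

Hypothesis e0 : 0 <= e.

Lemma principal_ideal_unit : principal_ideal e.
Proof. by exists 1; rewrite ?ler01 // scale1r abs_id. Qed.

Lemma principal_ideal_solid x y :
  principal_ideal y -> abs x <= abs y -> principal_ideal x.
Proof. by case=> C C0 yC xy; exists C => //; apply: le_trans yC. Qed.

Lemma principal_ideal_D x y :
  principal_ideal x -> principal_ideal y -> principal_ideal (x + y).
Proof.
move=> [C C0 xC] [D D0 yD]; exists (C + D); first exact: addr_ge0.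
by rewrite scalerDl; apply: le_trans (abs_triangle _ _) _; apply: riesz_leD.
Qed.

Lemma principal_ideal_scale a x : principal_ideal x -> principal_ideal (a *: x).
Proof.
move=> [C C0 xC]; exists (`|a| * C); first exact: mulr_ge0.
by rewrite scale_abs -scalerA; apply: riesz_leZ.
Qed.

Lemma principal_ideal_closed : riesz_closed principal_ideal.
Proof.
split=> [|a x y Dx Dy|x]; first by exists 0; rewrite // abs0 scale0r.
  by apply: principal_ideal_D => //; apply: principal_ideal_scale.
by move=> Dx; apply: principal_ideal_solid Dx _; rewrite abs_abs.
Qed.

(** [w] is a total function, but its values are constrained only on the ideal generated by [e]. *)
Record real_riesz_hom_on (w : V -> R) : Prop := RealRieszHomOn {
  real_riesz_hom_linear : forall a x y, principal_ideal x -> principal_ideal y ->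
    w (a *: x + y) = a * w x + w y;
  real_riesz_hom_abs : forall x, principal_ideal x -> w (abs x) = `|w x|
}.

Section RealRieszHom.
Variable w : V -> R.
Hypothesis w_hom : real_riesz_hom_on w.
Let D := principal_ideal.

Lemma real_riesz_hom_D x y : D x -> D y -> w (x + y) = w x + w y.
Proof.
by move=> Dx Dy; have := real_riesz_hom_linear w_hom 1 Dx Dy; rewrite scale1r mul1r.
Qed.

Lemma real_riesz_hom_0 : w 0 = 0.
Proof.
have [D0 _ _] := principal_ideal_closed.
by apply: (addrI (w 0)); rewrite -real_riesz_hom_D ?addr0.
Qed.

Lemma real_riesz_hom_scale a x : D x -> w (a *: x) = a * w x.
Proof.
have [D0 _ _] := principal_ideal_closed => Dx.
by rewrite -[a *: x]addr0 (real_riesz_hom_linear w_hom) // real_riesz_hom_0 addr0.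
Qed.

Lemma real_riesz_hom_ge0 x : D x -> 0 <= x -> 0 <= w x.
Proof.
by move=> Dx x0; rewrite -(abs_id x0) (real_riesz_hom_abs w_hom).
Qed.

Lemma real_riesz_hom_le x y : D x -> D y -> x <= y -> w x <= w y.
Proof.
move=> Dx Dy xy; have DNx : D (- x).
  by apply: principal_ideal_solid Dx _; rewrite absN.
rewrite -(subrK x y) real_riesz_hom_D ?lerDr //.
  by rewrite real_riesz_hom_ge0 ?riesz_subr_ge0 //; apply: principal_ideal_D.
exact: principal_ideal_D.
Qed.

End RealRieszHom.

Section StandardPart.
Variable P : V -> Prop.
Hypotheses (P_prime : prime_ideal P) (Pe : ~ P e).

(* [L x] says that [x >= 0] in the totally ordered quotient by [P]; [std x] is
   then the standard part of [x] in units of [e]. *)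
Let L x := P (neg x).
Definition standard_part x : R := sup [set r | L (x - r *: e)]%classic.
Let D := principal_ideal.
Let std := standard_part.

Let P0 : P 0.
Proof.
have [//|//] := prime_ideal_disjoint P_prime (riesz_meet_l (lexx 0)).
Qed.

Let L_ge0 x : 0 <= x -> L x. Proof. by move=> x0; rewrite /L neg_0. Qed.

Let LD x y : L x -> L y -> L (x + y).
Proof.
move=> Lx Ly; apply: (prime_ideal_solid P_prime (prime_ideal_D P_prime Lx Ly)).
  exact: neg_ge0.
apply: riesz_join_le; last by rewrite riesz_addr_ge0 ?neg_ge0.
by rewrite opprD; apply: riesz_leD; apply: le_pos.
Qed.

Let LZ a x : 0 <= a -> L x -> L (a *: x).
Proof. by move=> a0 Lx; rewrite /L scale_neg //; apply: prime_ideal_scale. Qed.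

Let L_total x : L x \/ L (- x).
Proof.
have [|] := prime_ideal_disjoint P_prime (meet_pos_neg x); last by left.
by right; rewrite /L negN.
Qed.

Let L_unit r : L (r *: e) -> 0 <= r.
Proof.
move=> Lr; rewrite leNgt; apply/negP => r0; apply: Pe.
have r0' : 0 <= - r^-1 by rewrite oppr_ge0 invr_le0 ltW.
have := LZ r0' Lr; rewrite scalerA mulNr mulVf ?lt_eqF // scaleN1r.
by rewrite /L negN pos_id.
Qed.

(** Lower and upper bounds of [x] by multiples of [e] are separated, as in a Dedekind cut; this
    makes the supremum in [standard_part] meaningful. *)
Let L_cmp x r s : L (x - r *: e) -> L (s *: e - x) -> r <= s.
Proof.
move=> Lr Ls; rewrite -subr_ge0; apply: L_unit.
by rewrite scalerBl -(subrK x (s *: e)) -addrA; apply: LD.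
Qed.

Let D_bounds x : D x -> exists C : R, L (x - (- C) *: e) /\ L (C *: e - x).
Proof.
case=> C C0 xC; exists C; split; apply: L_ge0; last first.
  by rewrite riesz_subr_ge0; apply: le_trans xC; apply: le_abs.
rewrite scaleNr opprK addrC -[x]opprK riesz_subr_ge0.
by apply: le_trans xC; apply: leN_abs.
Qed.

Let std_has_sup x : D x -> has_sup [set r | L (x - r *: e)]%classic.
Proof.
move=> /D_bounds[C [LC CL]]; split; first by exists (- C).
by exists C => r /= Lr; apply: L_cmp Lr CL.
Qed.

Let std_ge x r : D x -> L (x - r *: e) -> r <= std x.
Proof. by move=> Dx Lr; apply: sup_upper_bound => //; apply: std_has_sup. Qed.

Let std_le x r : D x -> L (r *: e - x) -> std x <= r.
Proof.
move=> Dx Lr; apply: ge_sup; first by case: (std_has_sup Dx).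
by move=> s /= Ls; apply: L_cmp Ls Lr.
Qed.

Let std_gt x r : D x -> r < std x -> L (x - r *: e).
Proof.
move=> Dx /sup_gt[|s /= Ls rs]; first by case: (std_has_sup Dx).
rewrite -[x](subrK (s *: e)) -addrA; apply: LD => //; apply: L_ge0.
by rewrite -scalerBl riesz_scale_ge0 // subr_ge0 ltW.
Qed.

Let std_lt x r : D x -> std x < r -> L (r *: e - x).
Proof.
move=> Dx xr; have [/(std_ge Dx)|] := L_total (x - r *: e).
  by rewrite leNgt xr.
by rewrite opprB.
Qed.

Let std_ideal x : D x -> 0 <= x -> P x -> std x = 0.
Proof.
move=> Dx x0 Px; apply/le_anti/andP; split.
  by apply: std_le => //; rewrite scale0r sub0r /L negN pos_id.
by apply: std_ge => //; rewrite scale0r subr0; apply: L_ge0.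
Qed.

Lemma standard_part_ge1 x : D x -> ~ P (pos (x - e)) -> 1 <= std x.
Proof.
move=> Dx Px; apply: std_ge => //; rewrite scale1r.
by have [//|] := prime_ideal_disjoint P_prime (meet_pos_neg (x - e)).
Qed.

Let stdD x y : D x -> D y -> std (x + y) = std x + std y.
Proof.
move=> Dx Dy; have Dxy := principal_ideal_D Dx Dy; apply/le_anti/andP; split.
  apply/ler_addgt0Pr => d d0.
  have d2 : 0 < d / 2 by rewrite divr_gt0.
  have := LD (std_lt Dx (ltr_pwDr d2 (lexx _))) (std_lt Dy (ltr_pwDr d2 (lexx _))).
  by rewrite addrACA -scalerDl -opprD => /(std_le Dxy); lra.
apply/ler_addgt0Pr => d d0.
have d2 : - (d / 2) < 0 by rewrite oppr_lt0 divr_gt0.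
have := LD (std_gt Dx (ltr_nwDr d2 (lexx _))) (std_gt Dy (ltr_nwDr d2 (lexx _))).
by rewrite addrACA -opprD -scalerDl => /(std_ge Dxy); lra.
Qed.

Let std0 : std 0 = 0.
Proof. by apply: (addrI (std 0)); rewrite -stdD ?addr0 //; case: principal_ideal_closed. Qed.

Let stdN x : D x -> std (- x) = - std x.
Proof.
move=> Dx; apply/eqP; rewrite -addr_eq0 addrC -stdD ?subrr ?std0 //.
by rewrite -scaleN1r; apply: principal_ideal_scale.
Qed.

Let std_pscale_le a x : 0 < a -> D x -> std (a *: x) <= a * std x.
Proof.
move=> a0 Dx; apply/ler_addgt0Pr => d d0.
have da : 0 < d / a by rewrite divr_gt0.
have := LZ (ltW a0) (std_lt Dx (ltr_pwDr da (lexx _))).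
rewrite scalerBr scalerA => /(std_le (principal_ideal_scale _ Dx)).
by rewrite mulrDr mulrCA divff ?gt_eqF // mulr1.
Qed.

Let stdZ a x : D x -> std (a *: x) = a * std x.
Proof.
(* The reverse inequality is [std_pscale_le] for the factor [b^-1] and the element [b *: y]. *)
have pos_case b y : 0 < b -> D y -> std (b *: y) = b * std y.
  move=> b0 Dy; apply/le_anti; rewrite std_pscale_le //=.
  have b0' : b != 0 by rewrite gt_eqF.
  rewrite -ler_pdivlMl // -{1}[y]scale1r -(mulVf b0') -scalerA.
  by apply: std_pscale_le; rewrite ?invr_gt0 //; apply: principal_ideal_scale.
move=> Dx; have [a0|a0|->] := ltgtP a 0; last by rewrite scale0r mul0r std0.
- rewrite -[a]opprK scaleNr stdN; last exact: principal_ideal_scale.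
  by rewrite pos_case ?oppr_gt0 // [RHS]mulNr.
- exact: pos_case.
Qed.

(** For absolute values: by primeness one of [pos x] and [neg x] is in [P], so its standard part is
    0 and that of the other is the norm of [std x]. *)
Lemma standard_part_hom : real_riesz_hom_on std.
Proof.
split=> [a x y Dx Dy|x Dx].
  by rewrite stdD ?stdZ //; apply: principal_ideal_scale.
have Dpos : D (pos x).
  apply: principal_ideal_solid Dx _; rewrite (abs_id (pos_ge0 x)) absE.
  by rewrite riesz_leDl ?neg_ge0.
have Dneg : D (neg x).
  apply: principal_ideal_solid Dx _; rewrite (abs_id (neg_ge0 x)) absE.
  by rewrite riesz_leDr ?pos_ge0.
have std_ge0 y : D y -> 0 <= y -> 0 <= std y.
  by move=> Dy y0; apply: std_ge => //; rewrite scale0r subr0; apply: L_ge0.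
have -> : std x = std (pos x) - std (neg x).
  by rewrite -stdN // -stdD ?posBneg // -scaleN1r; apply: principal_ideal_scale.
rewrite absE stdD //.
have [Pp|Pn] := prime_ideal_disjoint P_prime (meet_pos_neg x).
  rewrite (std_ideal Dpos (pos_ge0 x) Pp).
  by rewrite add0r sub0r normrN ger0_norm // std_ge0 // neg_ge0.
by rewrite (std_ideal Dneg (neg_ge0 x) Pn) addr0 subr0 ger0_norm // std_ge0 // pos_ge0.
Qed.

End StandardPart.

(** By the Archimedean property some multiple [p *+ n] of [abs x] is not below [e]. A prime ideal
    avoiding the positive part of [p *+ n - e] makes this multiple at least [e] in the quotient, so
    its standard part is at least 1. *)
Lemma exists_real_riesz_hom x : archimedean V -> principal_ideal x -> x != 0 ->
  exists2 w, real_riesz_hom_on w & w x != 0.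
Proof.
move=> archV Dx xn0; set p := abs x.
have [n npe] : exists n, ~ (p *+ n <= e).
  apply: contrapT => /forallNP pe; move/eqP: xn0; apply; apply: abs_eq0.
  by apply: (archV _ e) => [|n]; [apply: abs_ge0 | exact: contrapT (pe n)].
set v := pos (p *+ n - e).
have vn0 : v != 0.
  apply/eqP => v0; apply: npe; rewrite -riesz_subr_ge0.
  by rewrite -riesz_oppr_le0 opprB -v0; apply: le_pos.
have [P P_prime Pv] := prime_ideal_avoiding (pos_ge0 _) vn0.
have Dp : principal_ideal p by apply: principal_ideal_solid Dx _; rewrite abs_abs.
have nE : p *+ n = n%:R *: p by rewrite scaler_nat.
(* [v] lies below a multiple of [e], so an ideal containing [e] would contain [v]. *)
have Pe : ~ P e.
  move=> Pe; apply: Pv; have [C C0 xC] := Dx.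
  apply: (prime_ideal_solid P_prime (prime_ideal_scale P_prime (n%:R * C) Pe)).
    exact: pos_ge0.
  apply: riesz_join_le; last by rewrite riesz_scale_ge0 // mulr_ge0.
  rewrite nE -scalerA; apply: le_trans (riesz_leZ _ xC) => //.
  by rewrite -{2}[_ *: _]subr0 riesz_leD2l riesz_leN2.
have w_hom := standard_part_hom P_prime Pe.
exists (standard_part P) => //.
have [w_lin w_abs] := w_hom.
have Dnp : principal_ideal (n%:R *: p) by apply: principal_ideal_scale.
have := standard_part_ge1 P_prime Pe Dnp; rewrite -nE => /(_ Pv).
rewrite nE (real_riesz_hom_scale w_hom) // w_abs //.
by case: eqP => // ->; rewrite normr0 mulr0 ler10.
Qed.

End PrincipalIdeal.

(** * Additivity of Riesz homomorphisms on tensor products *)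

Section Bimorphism.
Variables (R : realType) (E F G : rieszType R) (phi : E -> F -> G).
Hypothesis phiP : riesz_bimorphism phi.
Implicit Types (x : E) (y : F).

Lemma bimorphism_linl y : linear (phi^~ y). Proof. by case: phiP => -[]. Qed.
Lemma bimorphism_linr x : linear (phi x). Proof. by case: phiP => -[]. Qed.

Lemma bimorphism_homl y : 0 <= y -> riesz_hom (phi^~ y).
Proof. by case: phiP => _ + _; apply. Qed.

Lemma bimorphism_homr x : 0 <= x -> riesz_hom (phi x).
Proof. by case: phiP => _ _; apply. Qed.

Lemma bimorphism_ge0 x y : 0 <= x -> 0 <= y -> 0 <= phi x y.
Proof. by move=> x0; apply: riesz_hom_ge0 (bimorphism_homr x0). Qed.

Lemma bimorphism_le x x' y y' : 0 <= x -> x <= x' -> 0 <= y -> y <= y' ->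
  phi x y <= phi x' y'.
Proof.
move=> x0 xx y0 yy; apply: (@le_trans _ _ (phi x' y)).
  exact: (riesz_hom_le (bimorphism_homl y0)).
by apply: (riesz_hom_le (bimorphism_homr _)) yy; apply: le_trans xx.
Qed.

Lemma bimorphism_absl x y : 0 <= y -> abs (phi x y) = phi (abs x) y.
Proof. by move=> y0; case: (bimorphism_homl y0) => _ ->. Qed.

Lemma bimorphism_abs x y : abs (phi x y) <= phi (abs x) (abs y).
Proof.
rewrite -{1}(posBneg y) (linear_B (bimorphism_linr x)) absE.
rewrite [X in _ <= phi _ X]absE (linear_D (bimorphism_linr _)).
rewrite -2?bimorphism_absl ?pos_ge0 ?neg_ge0 //.
rewrite -absE -[abs (phi x (neg y))]absN; exact: abs_triangle.
Qed.

End Bimorphism.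

Lemma riesz_bimorphismI (R : realType) (E F G : rieszType R) (phi : E -> F -> G) :
  bilinear_map phi ->
  (forall x x' y, meet x x' = 0 -> 0 <= y -> meet (phi x y) (phi x' y) = 0) ->
  (forall x y y', 0 <= x -> meet y y' = 0 -> meet (phi x y) (phi x y') = 0) ->
  riesz_bimorphism phi.
Proof.
move=> [linl linr] disjl disjr; split=> // [y y0|x x0].
  by apply: riesz_homI => // x x' xx; apply: disjl.
by apply: riesz_homI => // y y' yy; apply: disjr.
Qed.

(** Through [w], both [p] and [q] become real Riesz homomorphisms, and domination makes the first
    vanish wherever the second does; hence they are proportional. The product form avoids dividing
    by [w (q x1)], which may be 0. *)
Lemma real_hom_proportional (R : realType) (V G : rieszType R) (p q : V -> G)
    (e : G) (w : G -> R) (x x1 : V) :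
  riesz_hom p -> riesz_hom q -> (forall u, 0 <= u -> p u <= q u) ->
  real_riesz_hom_on e w -> 0 <= x -> x <= x1 -> principal_ideal e (q x1) ->
  w (p x) * w (q x1) = w (p x1) * w (q x).
Proof.
move=> p_hom q_hom pq w_hom x0 xx Dq1.
have [[p_lin p_abs] [q_lin q_abs]] := (p_hom, q_hom).
have [_ Dlin Dabs] := principal_ideal_closed e.
have Dpq u : 0 <= u -> principal_ideal e (q u) -> principal_ideal e (p u).
  move=> u0 Dq; apply: principal_ideal_solid Dq _.
  by rewrite !abs_id ?pq ?(riesz_hom_ge0 p_hom) ?(riesz_hom_ge0 q_hom).
have Dq : principal_ideal e (q x).
  apply: principal_ideal_solid Dq1 _.
  by rewrite !abs_id ?(riesz_hom_le q_hom) ?(riesz_hom_ge0 q_hom) // (le_trans x0 xx).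
have Dp := Dpq x x0 Dq; have Dp1 := Dpq x1 (le_trans x0 xx) Dq1.
(* The coefficients are chosen so that [w (q z) = 0]; since domination concerns positive elements
   only, it is used at [abs z]. *)
pose a := - w (q x1); pose b := w (q x); pose z := a *: x + b *: x1.
have D1 (h : V -> G) : linear h -> principal_ideal e (h x) -> principal_ideal e (h x1) ->
    principal_ideal e (h z) /\ w (h z) = a * w (h x) + b * w (h x1).
  move=> h_lin Dx Dx1; rewrite /z h_lin (linear_scale h_lin); split.
    by apply: Dlin => //; apply: principal_ideal_scale.
  rewrite (real_riesz_hom_linear w_hom) ?(real_riesz_hom_scale w_hom) //.
  exact: principal_ideal_scale.
have [Dqz Eqz] := D1 q q_lin Dq Dq1; have [Dpz Epz] := D1 p p_lin Dp Dp1.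
have qz0 : w (q (abs z)) = 0.
  rewrite q_abs (real_riesz_hom_abs w_hom) // Eqz; apply/eqP; rewrite normr_eq0.
  by rewrite mulNr mulrC addNr.
have pz0 : w (p z) = 0.
  apply/eqP; rewrite -normr_le0 -(real_riesz_hom_abs w_hom) // -p_abs -qz0.
  apply: (real_riesz_hom_le w_hom); rewrite ?pq ?abs_ge0 //; last by rewrite q_abs; apply: Dabs.
  by rewrite p_abs; apply: Dabs.
by move: pz0; rewrite Epz mulNr addrC => /eqP; rewrite subr_eq0 => /eqP E; rewrite mulrC -E mulrC.
Qed.

Section Tensor.
Variables (R : realType) (E F T : rieszType R) (tens : E -> F -> T).
Hypothesis tensP : riesz_tensor_product tens.
Let bimT := rtp_bimorphism tensP.

Lemma riesz_tensor_le t : exists x y, [/\ 0 <= x, 0 <= y & abs t <= tens x y].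
Proof.
pose P t := exists x y, [/\ 0 <= x, 0 <= y & abs t <= tens x y].
suff clP : riesz_closed P.
  apply: (riesz_tensor_ind clP tensP) => x y.
  by exists (abs x), (abs y); rewrite !abs_ge0; split=> //; apply: bimorphism_abs.
split=> [|a s s' [x [y [x0 y0 tx]]] [x' [y' [x'0 y'0 tx']]]|s [x [y [x0 y0 tx]]]].
- exists 0, 0; split=> //.
  by rewrite abs0 (linear_0 (bimorphism_linl bimT 0)).
- have ax0 : 0 <= `|a| *: x by apply: riesz_scale_ge0.
  (* Expanding the first factor leaves two tensors, which majorize the two summands separately. *)
  exists (`|a| *: x + x'), (y + y'); rewrite !riesz_addr_ge0 //; split=> //.
  apply: le_trans (abs_triangle _ _) _.
  rewrite (linear_D (bimorphism_linl bimT _)); apply: riesz_leD.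
    rewrite scale_abs (linear_scale (bimorphism_linl bimT _)); apply: riesz_leZ => //.
    by apply: le_trans tx _; apply: (bimorphism_le bimT) => //; apply: riesz_leDl.
  by apply: le_trans tx' _; apply: (bimorphism_le bimT) => //; apply: riesz_leDr.
by exists x, y; rewrite abs_abs.
Qed.

Lemma riesz_tensor_ind_ge0 (P : T -> Prop) : riesz_closed P ->
  (forall x y, 0 <= x -> 0 <= y -> P (tens x y)) -> forall t, P t.
Proof.
move=> clP Ptens; have [P0 Plin _] := clP.
have PB s t : P s -> P t -> P (s - t).
  by move=> Ps Pt; rewrite addrC -scaleN1r; apply: Plin.
apply: (riesz_tensor_ind clP tensP) => x y.
rewrite -(posBneg x) -(posBneg y) (linear_B (bimorphism_linl bimT _)).
rewrite !(linear_B (bimorphism_linr bimT _)).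
by apply: (PB); apply: (PB); apply: (Ptens); rewrite ?pos_ge0 ?neg_ge0.
Qed.

Variable G : rieszType R.

(* For a real Riesz homomorphism [w], both [w \o f] and [w \o g] restrict to Riesz
   bimorphisms into the reals, so that the first is a multiple of the second.
   Allowing all larger [x1], [y1] lets two elements share a common majorant. *)
Definition dominated_at (f g : T -> G) (t : T) : Prop :=
  exists x0 y0, [/\ 0 <= x0, 0 <= y0 &
    forall x1 y1 e w, x0 <= x1 -> y0 <= y1 ->
      real_riesz_hom_on e w -> principal_ideal e (g (tens x1 y1)) ->
      [/\ principal_ideal e (f t), principal_ideal e (g t) &
          w (f t) * w (g (tens x1 y1)) = w (f (tens x1 y1)) * w (g t)]].

(** The identity is linear in [t], and survives absolute values because its coefficients
    [w (g (tens x1 y1))] and [w (f (tens x1 y1))] are nonnegative. For a combination, the sums of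
    the two thresholds serve both terms. *)
Lemma dominated_at_closed (f g : T -> G) : riesz_hom f -> riesz_hom g ->
  (forall x y, 0 <= x -> 0 <= y -> f (tens x y) <= g (tens x y)) ->
  riesz_closed (dominated_at f g).
Proof.
move=> f_hom g_hom fg; have [[f_lin f_abs] [g_lin g_abs]] := (f_hom, g_hom).
split.
- exists 0, 0; split=> // x1 y1 e w _ _ w_hom _.
  have [D0 _ _] := principal_ideal_closed e.
  by rewrite (linear_0 f_lin) (linear_0 g_lin) (real_riesz_hom_0 w_hom) mul0r mulr0.
- move=> a s t [x [y [x0 y0 Hs]]] [x' [y' [x'0 y'0 Ht]]].
  exists (x + x'), (y + y'); rewrite !riesz_addr_ge0 //; split=> // x1 y1 e w xx yy w_hom De.
  have [Dfs Dgs Es] := Hs x1 y1 e w (le_trans (riesz_leDl _ x'0) xx)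
    (le_trans (riesz_leDl _ y'0) yy) w_hom De.
  have [Dft Dgt Et] := Ht x1 y1 e w (le_trans (riesz_leDr _ x0) xx)
    (le_trans (riesz_leDr _ y0) yy) w_hom De.
  have [_ Dlin _] := principal_ideal_closed e.
  rewrite f_lin g_lin !(real_riesz_hom_linear w_hom) //; split; try exact: Dlin.
  by rewrite mulrDl mulrDr -Et -mulrA Es mulrCA.
move=> t [x [y [x0 y0 Ht]]]; exists x, y; split=> // x1 y1 e w xx yy w_hom De.
have [Df Dg Et] := Ht x1 y1 e w xx yy w_hom De.
have [_ _ Dabs] := principal_ideal_closed e.
rewrite f_abs g_abs !(real_riesz_hom_abs w_hom) //; split; try exact: Dabs.
have x10 := le_trans x0 xx; have y10 := le_trans y0 yy.
have t0 := bimorphism_ge0 bimT x10 y10.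
have g0 := riesz_hom_ge0 g_hom t0; have f0 := riesz_hom_ge0 f_hom t0.
have wg0 := real_riesz_hom_ge0 w_hom De g0.
have wf0 : 0 <= w (f (tens x1 y1)).
  apply: (real_riesz_hom_ge0 w_hom) => //; apply: principal_ideal_solid De _.
  by rewrite !abs_id // fg.
by rewrite -{1}(ger0_norm wg0) -{1}(ger0_norm wf0) -!normrM Et.
Qed.

(** Proportionality is applied twice: from [x] to [x1] with [y] fixed, then from [y] to [y1] with
    [x1] fixed. *)
Lemma dominated_at_tens (f g : T -> G) x y : riesz_hom f -> riesz_hom g ->
  (forall x y, 0 <= x -> 0 <= y -> f (tens x y) <= g (tens x y)) ->
  0 <= x -> 0 <= y -> dominated_at f g (tens x y).
Proof.
move=> f_hom g_hom fg x0 y0; exists x, y; split=> // x1 y1 e w xx yy w_hom De.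
have x10 := le_trans x0 xx; have y10 := le_trans y0 yy.
have f_ge0 u v : 0 <= u -> 0 <= v -> 0 <= f (tens u v).
  by move=> u0 v0; apply: (riesz_hom_ge0 f_hom); apply: bimorphism_ge0.
have g_ge0 u v : 0 <= u -> 0 <= v -> 0 <= g (tens u v).
  by move=> u0 v0; apply: (riesz_hom_ge0 g_hom); apply: bimorphism_ge0.
have Dg u v : 0 <= u -> u <= x1 -> 0 <= v -> v <= y1 ->
    principal_ideal e (g (tens u v)).
  move=> u0 ux v0 vy; apply: principal_ideal_solid De _; rewrite !abs_id ?g_ge0 //.
  by apply: (riesz_hom_le g_hom); apply: bimorphism_le.
have Df u v : 0 <= u -> u <= x1 -> 0 <= v -> v <= y1 ->
    principal_ideal e (f (tens u v)).
  move=> u0 ux v0 vy; apply: principal_ideal_solid (Dg u v u0 ux v0 vy) _.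
  by rewrite !abs_id ?g_ge0 ?f_ge0 ?fg.
split; [exact: Df | exact: Dg |].
have hom_l (h : T -> G) v : riesz_hom h -> 0 <= v -> riesz_hom (fun u => h (tens u v)).
  by move=> h_hom v0; apply: riesz_hom_comp (bimorphism_homl bimT v0).
have hom_r (h : T -> G) u : riesz_hom h -> 0 <= u -> riesz_hom (fun v => h (tens u v)).
  by move=> h_hom u0; apply: riesz_hom_comp (bimorphism_homr bimT u0).
have Ex := real_hom_proportional (hom_l f y f_hom y0) (hom_l g y g_hom y0)
  (fun u u0 => fg u y u0 y0) w_hom x0 xx (Dg x1 y x10 (lexx _) y0 yy).
have Ey := real_hom_proportional (hom_r f x1 f_hom x10) (hom_r g x1 g_hom x10)
  (fun v v0 => fg x1 v x10 v0) w_hom y0 yy (Dg x1 y1 x10 (lexx _) y10 (lexx _)).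
rewrite /= in Ex Ey.
(* The intermediate value [w (g (tens x1 y))] is cancelled when nonzero; when it is 0, domination
   forces both sides of the goal to be 0. *)
have [q0|q0] := eqVneq (w (g (tens x1 y))) 0; last first.
  apply: (mulIf q0); rewrite mulrAC Ex -mulrA mulrCA.
  by rewrite [RHS]mulrAC -Ey; ring.
have gxy : w (g (tens x y)) = 0.
  apply/le_anti; rewrite -{1}q0 (real_riesz_hom_ge0 w_hom) ?g_ge0 ?andbT //; last exact: Dg.
  apply: (real_riesz_hom_le w_hom); try exact: Dg.
  by apply: (riesz_hom_le g_hom); apply: bimorphism_le.
have fxy : w (f (tens x y)) = 0.
  apply/le_anti; rewrite -{1}gxy (real_riesz_hom_ge0 w_hom) ?f_ge0 ?andbT //; last exact: Df.
  apply: (real_riesz_hom_le w_hom); [exact: Df | exact: Dg | exact: fg].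
by rewrite gxy fxy mul0r mulr0.
Qed.

Hypothesis archG : archimedean G.

Lemma riesz_tensor_hom_eq_ge0 (f g : T -> G) : riesz_hom f -> riesz_hom g ->
  (forall x y, 0 <= x -> 0 <= y -> f (tens x y) = g (tens x y)) -> forall t, f t = g t.
Proof.
move=> [f_lin f_abs] [g_lin g_abs] fg; apply: riesz_tensor_ind_ge0 => //.
split=> [|a x y xE yE|x xE]; first by rewrite (linear_0 f_lin) (linear_0 g_lin).
  by rewrite f_lin g_lin xE yE.
by rewrite f_abs g_abs xE.
Qed.

(** Let [e] be [f3 (tens x1 y1)] at a common threshold. Adding the identities for [f1] and [f2]
    gives [(w (f1 t) + w (f2 t)) * w e = w e * w (f3 t)], so no real homomorphism on the ideal of
    [e] separates the two sides. *)
Lemma riesz_tensor_hom_add (f1 f2 f3 : T -> G) :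
  riesz_hom f1 -> riesz_hom f2 -> riesz_hom f3 ->
  (forall x y, 0 <= x -> 0 <= y -> f3 (tens x y) = f1 (tens x y) + f2 (tens x y)) ->
  forall t, f3 t = f1 t + f2 t.
Proof.
move=> f1_hom f2_hom f3_hom fE t.
have tens0 x y : 0 <= x -> 0 <= y -> 0 <= tens x y by apply: bimorphism_ge0.
have f13 x y : 0 <= x -> 0 <= y -> f1 (tens x y) <= f3 (tens x y).
  by move=> x0 y0; rewrite fE // riesz_leDl // riesz_hom_ge0 // tens0.
have f23 x y : 0 <= x -> 0 <= y -> f2 (tens x y) <= f3 (tens x y).
  by move=> x0 y0; rewrite fE // riesz_leDr // riesz_hom_ge0 // tens0.
have dom f : riesz_hom f ->
    (forall x y, 0 <= x -> 0 <= y -> f (tens x y) <= f3 (tens x y)) -> dominated_at f f3 t.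
  move=> f_hom ff; apply: riesz_tensor_ind_ge0 (dominated_at_closed f_hom f3_hom ff) _ t => x y.
  exact: dominated_at_tens.
have [x [y [x0 y0 H1]]] := dom f1 f1_hom f13.
have [x' [y' [x'0 y'0 H2]]] := dom f2 f2_hom f23.
set x1 := x + x'; set y1 := y + y'; set e := f3 (tens x1 y1).
have t1 : 0 <= tens x1 y1 by rewrite tens0 ?riesz_addr_ge0.
have e0 : 0 <= e by apply: riesz_hom_ge0.
have De := principal_ideal_unit e0.
apply/eqP; rewrite -subr_eq0; apply/negPn/negP => d0.
have {}H1 w w_hom := H1 x1 y1 e w (riesz_leDl _ x'0) (riesz_leDl _ y'0) w_hom De.
have {}H2 w w_hom := H2 x1 y1 e w (riesz_leDr _ x0) (riesz_leDr _ y0) w_hom De.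
(* The zero functional extracts from [H1] and [H2] the memberships in the ideal, which must be known
   before a separating [w] can be chosen. *)
have w0_hom : real_riesz_hom_on e (fun=> 0).
  by split=> [a u v _ _|u _]; rewrite ?normr0 ?mulr0 ?addr0.
have [D1 D3 _] := H1 _ w0_hom; have [D2 _ _] := H2 _ w0_hom.
have DN u : principal_ideal e u -> principal_ideal e (- u).
  by move=> Du; apply: principal_ideal_solid Du _; rewrite absN.
have D12 := principal_ideal_D D1 D2.
have Dd : principal_ideal e (f3 t - (f1 t + f2 t)) by apply: principal_ideal_D => //; apply: DN.
have [w w_hom wd] := exists_real_riesz_hom e0 archG Dd d0.
have [_ _ E1] := H1 w w_hom; have [_ _ E2] := H2 w w_hom.
have t1E := fE x1 y1 (riesz_addr_ge0 x0 x'0) (riesz_addr_ge0 y0 y'0).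
have Dfe f : riesz_hom f -> f (tens x1 y1) <= e -> principal_ideal e (f (tens x1 y1)).
  move=> f_hom fe; apply: principal_ideal_solid De _.
  by rewrite !abs_id // (riesz_hom_ge0 f_hom).
have Df1 := Dfe f1 f1_hom (f13 _ _ (riesz_addr_ge0 x0 x'0) (riesz_addr_ge0 y0 y'0)).
have Df2 := Dfe f2 f2_hom (f23 _ _ (riesz_addr_ge0 x0 x'0) (riesz_addr_ge0 y0 y'0)).
have we : w e = w (f1 (tens x1 y1)) + w (f2 (tens x1 y1)).
  by rewrite /e t1E (real_riesz_hom_D w_hom).
have wB : w (f3 t - (f1 t + f2 t)) = w (f3 t) - (w (f1 t) + w (f2 t)).
  rewrite addrC -scaleN1r (real_riesz_hom_linear w_hom) // (real_riesz_hom_D w_hom) //.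
  by rewrite mulN1r addrC.
(* If [w e] were 0, then [w] would vanish on the whole ideal generated by [e]. *)
have we0 : w e != 0.
  apply: contra wd => /eqP we0; have [C C0 dC] := Dd.
  rewrite -normr_le0 -(real_riesz_hom_abs w_hom) // -(mulr0 C) -we0.
  rewrite -(real_riesz_hom_scale w_hom) //; apply: (real_riesz_hom_le w_hom) => //.
    by apply: principal_ideal_solid Dd _; rewrite abs_abs.
  exact: principal_ideal_scale.
move/eqP: wd; apply; apply: (mulIf we0).
by rewrite wB mul0r mulrBl mulrDl E1 E2 -mulrDl -we mulrC subrr.
Qed.

End Tensor.

(** * Orthomorphisms *)

(** Positivity is built in: for [0 <= x], the elements [x] and 0 are disjoint, so
    [meet (p x) 0 = 0]. *)
Definition positive_orthomorphism (R : realType) (V : rieszType R) (p : V -> V) :=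
  linear p /\ forall x y, meet x y = 0 -> meet (p x) y = 0.

Section Orthomorphism.
Variables (R : realType) (V : rieszType R).

Lemma orthomorphism_disjoint (p : V -> V) x y : positive_orthomorphism p ->
  meet x y = 0 -> meet (p x) (p y) = 0.
Proof. by case=> _ pP xy; rewrite (pP) // riesz_meetC pP // riesz_meetC. Qed.

Lemma orthomorphism_hom (p : V -> V) : positive_orthomorphism p -> riesz_hom p.
Proof.
by move=> pP; apply: riesz_homI (fun x y => orthomorphism_disjoint pP); case: pP.
Qed.

(** Each summand on one side is disjoint from each on the other; the mixed pairs are where band
    preservation enters, beyond preservation of disjointness. *)
Lemma orthomorphism_add1_disjoint (p : V -> V) x y : positive_orthomorphism p ->
  meet x y = 0 -> meet (p x + x) (p y + y) = 0.
Proof.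
move=> pP xy; have [_ pd] := pP; have yx : meet y x = 0 by rewrite riesz_meetC.
have D z : meet z x = 0 -> meet z (p x) = 0.
  by move=> zx; rewrite riesz_meetC pd // riesz_meetC.
rewrite riesz_meetC; apply: disjointD; rewrite riesz_meetC; apply: disjointD.
- exact: orthomorphism_disjoint.
- exact: pd.
- by rewrite riesz_meetC pd.
- by [].
Qed.

Lemma falg_mulr_orthomorphism (mul : V -> V -> V) h : f_algebra mul -> 0 <= h ->
  positive_orthomorphism (mul^~ h).
Proof.
case=> -[_ [linl _] _] disj h0; split; first exact: linl.
by move=> x y /disj/(_ h0)[].
Qed.

Lemma falg_mull_orthomorphism (mul : V -> V -> V) h : f_algebra mul -> 0 <= h ->
  positive_orthomorphism (mul h).
Proof.
case=> -[_ [_ linr] _] disj h0; split; first exact: linr.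
by move=> x y /disj/(_ h0)[].
Qed.

Lemma riesz_hom_scale (W : rieszType R) (a : R) (f : V -> W) : 0 <= a -> riesz_hom f ->
  riesz_hom (fun x => a *: f x).
Proof.
move=> a0 [f_lin f_abs]; split=> [b x y|x].
  by rewrite f_lin scalerDr !scalerA mulrC.
by rewrite f_abs scale_abs ger0_norm.
Qed.

End Orthomorphism.

Section TensorLift.
Variables (R : realType) (E F T : rieszType R) (tens : E -> F -> T).
Hypothesis tensP : riesz_tensor_product tens.
Let bimT := rtp_bimorphism tensP.
Let archT := rtp_archimedean tensP.

(** The induced map is chosen by [xget], with the zero function as default when no such map
    exists. *)
Definition tensor_lift (G : rieszType R) (phi : E -> F -> G) : T -> G :=
  xget (fun=> 0) [set h | riesz_hom h /\ forall x y, h (tens x y) = phi x y]%classic.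

Lemma tensor_liftP (G : rieszType R) (phi : E -> F -> G) :
  archimedean G -> riesz_bimorphism phi ->
  riesz_hom (tensor_lift phi) /\ forall x y, tensor_lift phi (tens x y) = phi x y.
Proof.
move=> archG phiP; have [h [h_spec _]] := rtp_universal tensP archG phiP.
exact: (@xgetPex _ (fun=> 0)
  [set h | riesz_hom h /\ forall x y, h (tens x y) = phi x y]%classic (ex_intro _ h h_spec)).
Qed.

Section TensorOrthomorphism.
Variables (p : E -> E) (q : F -> F).
Hypotheses (pP : positive_orthomorphism p) (qP : positive_orthomorphism q).

Let p_hom := orthomorphism_hom pP.
Let q_hom := orthomorphism_hom qP.

Lemma tens_orthomorphism_bimorphism : riesz_bimorphism (fun x y => tens (p x) (q y)).
Proof.
have [[p_lin _] [q_lin _]] := (pP, qP).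
apply: riesz_bimorphismI; first split.
- by move=> y a x x'; rewrite p_lin (bimorphism_linl bimT).
- by move=> x a y y'; rewrite q_lin (bimorphism_linr bimT).
- move=> x x' y xx y0.
  apply: (riesz_hom_meet0 (bimorphism_homl bimT (riesz_hom_ge0 q_hom y0))).
  exact: orthomorphism_disjoint.
move=> x y y' x0 yy.
apply: (riesz_hom_meet0 (bimorphism_homr bimT (riesz_hom_ge0 p_hom x0))).
exact: orthomorphism_disjoint.
Qed.

(** On positive arguments the sum lies below [tens (p x + x) (q y + y)], which preserves
    disjointness in each variable; smaller positive values stay disjoint. *)
Lemma tens_orthomorphism_add1_bimorphism :
  riesz_bimorphism (fun x y => tens (p x) (q y) + tens x y).
Proof.
have [[linl linr] _ _] := tens_orthomorphism_bimorphism.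
have p0 x : 0 <= x -> 0 <= p x by apply: riesz_hom_ge0.
have q0 y : 0 <= y -> 0 <= q y by apply: riesz_hom_ge0.
have le x y : 0 <= x -> 0 <= y ->
    0 <= tens (p x) (q y) + tens x y <= tens (p x + x) (q y + y).
  move=> x0 y0; have [px qy] := (p0 x x0, q0 y y0).
  rewrite riesz_addr_ge0 ?(bimorphism_ge0 bimT) //=.
  rewrite (linear_D (bimorphism_linl bimT _)); apply: riesz_leD.
    by apply: (bimorphism_le bimT) => //; apply: riesz_leDl.
  by apply: (bimorphism_le bimT) => //; apply: riesz_leDr.
apply: riesz_bimorphismI; first split.
- move=> y a x x' /=; rewrite linl (bimorphism_linl bimT).
  by rewrite scalerDr addrACA.
- move=> x a y y' /=; rewrite linr (bimorphism_linr bimT).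
  by rewrite scalerDr addrACA.
- move=> x x' y xx y0; have [x0 x'0] := disjoint_ge0 xx.
  have /andP[a0 al] := le x y x0 y0; have /andP[b0 bl] := le x' y x'0 y0.
  apply: disjoint_le a0 b0 al bl.
  apply: (riesz_hom_meet0 (bimorphism_homl bimT _)).
    by rewrite riesz_addr_ge0 ?q0.
  exact: orthomorphism_add1_disjoint.
move=> x y y' x0 yy; have [y0 y'0] := disjoint_ge0 yy.
have /andP[a0 al] := le x y x0 y0; have /andP[b0 bl] := le x y' x0 y'0.
apply: disjoint_le a0 b0 al bl.
apply: (riesz_hom_meet0 (bimorphism_homr bimT _)).
  by rewrite riesz_addr_ge0 ?p0.
exact: orthomorphism_add1_disjoint.
Qed.

(* [h + id] is again induced by a Riesz bimorphism, hence a Riesz homomorphism;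
   this makes [h] band preserving. *)
Lemma tensor_orthomorphism (h : T -> T) : riesz_hom h ->
  (forall x y, 0 <= x -> 0 <= y -> h (tens x y) = tens (p x) (q y)) ->
  positive_orthomorphism h.
Proof.
move=> h_hom hE; split; first by case: h_hom.
have [k_hom kE] := tensor_liftP archT tens_orthomorphism_add1_bimorphism.
set k := tensor_lift _ in k_hom kE.
have id_hom : riesz_hom (@id T) by split.
have khE : forall t, k t = h t + t.
  by apply: (riesz_tensor_hom_add tensP archT h_hom id_hom k_hom) => x y x0 y0; rewrite kE hE.
move=> s t st; have [s0 t0] := disjoint_ge0 st.
have [hs0 ht0] := (riesz_hom_ge0 h_hom s0, riesz_hom_ge0 h_hom t0).
(* [h s <= k s] and [t <= k t], while [k s] and [k t] are disjoint. *)
apply: (disjoint_le (riesz_hom_meet0 k_hom st)) => //; rewrite khE.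
  exact: riesz_leDl.
exact: riesz_leDr.
Qed.

End TensorOrthomorphism.

End TensorLift.

(** * The product *)

Lemma bilinear_assoc_ge0 (R : realType) (V : rieszType R) (mul : V -> V -> V) :
  bilinear_map mul ->
  (forall u v w, 0 <= v -> 0 <= w -> mul u (mul v w) = mul (mul u v) w) ->
  associative mul.
Proof.
move=> [mull mulr] assoc_ge0 u v w; rewrite -(posBneg v) -(posBneg w).
rewrite !(linear_B (mulr _)) !(linear_B (mull _)) !(linear_B (mulr _)).
by rewrite !assoc_ge0 ?pos_ge0 ?neg_ge0.
Qed.

Section TensorProduct.
Variables (R : realType) (A B T : rieszType R).
Variables (mulA : A -> A -> A) (mulB : B -> B -> B) (tens : A -> B -> T).
Hypotheses (fA : f_algebra mulA) (fB : f_algebra mulB).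
Hypothesis tensP : riesz_tensor_product tens.
Let bimT := rtp_bimorphism tensP.
Let archT := rtp_archimedean tensP.

Let mulA_bil : bilinear_map mulA := loa_bilinear (falg_loa fA).
Let mulB_bil : bilinear_map mulB := loa_bilinear (falg_loa fB).

(** Left multiplication by [tens a b], intended for positive [a] and [b], where the lifted map is a
    Riesz bimorphism. *)
Definition tensor_lmul a b : T -> T :=
  tensor_lift tens (fun x y => tens (mulA a x) (mulB b y)).

Lemma tensor_lmul_hom a b : 0 <= a -> 0 <= b -> riesz_hom (tensor_lmul a b).
Proof.
move=> a0 b0; apply: (tensor_liftP tensP archT _).1.
exact (tens_orthomorphism_bimorphism tensP (falg_mull_orthomorphism fA a0)
  (falg_mull_orthomorphism fB b0)).
Qed.

Lemma tensor_lmulE a b x y : 0 <= a -> 0 <= b ->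
  tensor_lmul a b (tens x y) = tens (mulA a x) (mulB b y).
Proof.
move=> a0 b0; apply: (tensor_liftP tensP archT _).2.
exact (tens_orthomorphism_bimorphism tensP (falg_mull_orthomorphism fA a0)
  (falg_mull_orthomorphism fB b0)).
Qed.

Lemma tensor_lmulDl a a' b t : 0 <= a -> 0 <= a' -> 0 <= b ->
  tensor_lmul (a + a') b t = tensor_lmul a b t + tensor_lmul a' b t.
Proof.
move=> a0 a'0 b0; have aa0 := riesz_addr_ge0 a0 a'0; move: t.
apply: (riesz_tensor_hom_add tensP archT); try exact: tensor_lmul_hom.
move=> x y x0 y0; rewrite !tensor_lmulE // (linear_D (mulA_bil.1 x)).
by rewrite (linear_D (bimorphism_linl bimT _)).
Qed.

Lemma tensor_lmulDr a b b' t : 0 <= a -> 0 <= b -> 0 <= b' ->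
  tensor_lmul a (b + b') t = tensor_lmul a b t + tensor_lmul a b' t.
Proof.
move=> a0 b0 b'0; have bb0 := riesz_addr_ge0 b0 b'0; move: t.
apply: (riesz_tensor_hom_add tensP archT); try exact: tensor_lmul_hom.
move=> x y x0 y0; rewrite !tensor_lmulE // (linear_D (mulB_bil.1 y)).
by rewrite (linear_D (bimorphism_linr bimT _)).
Qed.

Lemma tensor_lmulZl c a b t : 0 <= c -> 0 <= a -> 0 <= b ->
  tensor_lmul (c *: a) b t = c *: tensor_lmul a b t.
Proof.
move=> c0 a0 b0; have ca0 := riesz_scale_ge0 c a c0 a0; move: t.
apply: (riesz_tensor_hom_eq_ge0 tensP); first exact: tensor_lmul_hom.
  by apply: riesz_hom_scale => //; apply: tensor_lmul_hom.
move=> x y x0 y0; rewrite !tensor_lmulE // (linear_scale (mulA_bil.1 x)).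
by rewrite (linear_scale (bimorphism_linl bimT _)).
Qed.

Lemma tensor_lmulZr c a b t : 0 <= c -> 0 <= a -> 0 <= b ->
  tensor_lmul a (c *: b) t = c *: tensor_lmul a b t.
Proof.
move=> c0 a0 b0; have cb0 := riesz_scale_ge0 c b c0 b0; move: t.
apply: (riesz_tensor_hom_eq_ge0 tensP); first exact: tensor_lmul_hom.
  by apply: riesz_hom_scale => //; apply: tensor_lmul_hom.
move=> x y x0 y0; rewrite !tensor_lmulE // (linear_scale (mulB_bil.1 y)).
by rewrite (linear_scale (bimorphism_linr bimT _)).
Qed.

Definition tensor_lmul_ext (t : T) (a : A) (b : B) : T :=
  cone_ext (fun a' => cone_ext (fun b' => tensor_lmul a' b' t) b) a.

(** Linearity in [a] comes from the outer extension; linearity in [b] from the inner extensions at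
    [pos a] and [neg a]. *)
Lemma tensor_lmul_ext_bilinear t : bilinear_map (tensor_lmul_ext t).
Proof.
split=> [b|a].
  apply: cone_ext_linear => [a a' a0 a'0|c a c0 a0]; rewrite /cone_ext.
    by rewrite !tensor_lmulDl ?pos_ge0 ?neg_ge0 // opprD addrACA.
  by rewrite !tensor_lmulZl ?pos_ge0 ?neg_ge0 // scalerBr.
pose L a' := cone_ext (fun b' => tensor_lmul a' b' t).
have lin a' : 0 <= a' -> linear (L a').
  move=> a'0; apply: cone_ext_linear => [b b' b0 b'0|c b c0 b0].
    exact: tensor_lmulDr.
  exact: tensor_lmulZr.
move=> c b b'; have E b1 : tensor_lmul_ext t a b1 = L (pos a) b1 - L (neg a) b1 by [].
rewrite !E.
rewrite !lin ?pos_ge0 ?neg_ge0 //.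
by rewrite opprD addrACA [in RHS]scalerBr.
Qed.

Lemma tensor_lmul_extE t a b : 0 <= a -> 0 <= b ->
  tensor_lmul_ext t a b = tensor_lmul a b t.
Proof.
move=> a0 b0; rewrite /tensor_lmul_ext (cone_ext_id _ a0) => [|a1 a2 a10 a20].
  by rewrite (cone_ext_id _ b0) // => b1 b2 b10 b20; rewrite tensor_lmulDr.
by rewrite /cone_ext !tensor_lmulDl ?pos_ge0 ?neg_ge0 // opprD addrACA.
Qed.

(** With [t] below [tens x y], the value at positive [a], [b] lies below
    [tens (mulA a x) (mulB b y)], and right multiplications by [x] and [y] preserve disjointness. *)
Lemma tensor_lmul_ext_bimorphism t : 0 <= t -> riesz_bimorphism (tensor_lmul_ext t).
Proof.
move=> t0; have [x [y [x0 y0 txy]]] := riesz_tensor_le tensP t.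
have bound a b : 0 <= a -> 0 <= b ->
    0 <= tensor_lmul_ext t a b <= tens (mulA a x) (mulB b y).
  move=> a0 b0; rewrite tensor_lmul_extE // -tensor_lmulE //.
  have h := tensor_lmul_hom a0 b0; rewrite (riesz_hom_ge0 h) //=.
  by apply: (riesz_hom_le h); apply: le_trans txy; apply: le_abs.
have [pA pB] := (falg_mulr_orthomorphism fA x0, falg_mulr_orthomorphism fB y0).
apply: riesz_bimorphismI; first exact: tensor_lmul_ext_bilinear.
- move=> a a' b aa b0; have [a0 a'0] := disjoint_ge0 aa.
  have /andP[l0 l1] := bound a b a0 b0; have /andP[r0 r1] := bound a' b a'0 b0.
  apply: (disjoint_le _ l0 r0 l1 r1).
  apply: (riesz_hom_meet0 (bimorphism_homl bimT _)).
    exact: (riesz_hom_ge0 (orthomorphism_hom pB)).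
  exact: (orthomorphism_disjoint (falg_mulr_orthomorphism fA x0) aa).
move=> a b b' a0 bb; have [b0 b'0] := disjoint_ge0 bb.
have /andP[l0 l1] := bound a b a0 b0; have /andP[r0 r1] := bound a b' a0 b'0.
apply: (disjoint_le _ l0 r0 l1 r1).
apply: (riesz_hom_meet0 (bimorphism_homr bimT _)).
  exact: (riesz_hom_ge0 (orthomorphism_hom pA)).
exact: (orthomorphism_disjoint (falg_mulr_orthomorphism fB y0) bb).
Qed.

Definition tensor_rmul (t : T) : T -> T := tensor_lift tens (tensor_lmul_ext t).

Lemma tensor_rmul_hom t : 0 <= t -> riesz_hom (tensor_rmul t).
Proof. by move=> t0; apply: (tensor_liftP tensP archT (tensor_lmul_ext_bimorphism t0)).1. Qed.

Lemma tensor_rmulE t a b : 0 <= t -> tensor_rmul t (tens a b) = tensor_lmul_ext t a b.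
Proof. by move=> t0; apply: (tensor_liftP tensP archT (tensor_lmul_ext_bimorphism t0)).2. Qed.

Lemma tensor_rmulD s t u : 0 <= s -> 0 <= t ->
  tensor_rmul (s + t) u = tensor_rmul s u + tensor_rmul t u.
Proof.
move=> s0 t0; have st0 := riesz_addr_ge0 s0 t0; move: u.
apply: (riesz_tensor_hom_add tensP archT); try exact: tensor_rmul_hom.
move=> a b a0 b0; rewrite !tensor_rmulE // !tensor_lmul_extE //.
by rewrite (linear_D (tensor_lmul_hom a0 b0).1).
Qed.

Lemma tensor_rmulZ c t u : 0 <= c -> 0 <= t ->
  tensor_rmul (c *: t) u = c *: tensor_rmul t u.
Proof.
move=> c0 t0; have ct0 := riesz_scale_ge0 c t c0 t0; move: u.
apply: (riesz_tensor_hom_eq_ge0 tensP); first exact: tensor_rmul_hom.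
  by apply: riesz_hom_scale => //; apply: tensor_rmul_hom.
move=> a b a0 b0; rewrite !tensor_rmulE // !tensor_lmul_extE //.
by rewrite (linear_scale (tensor_lmul_hom a0 b0).1).
Qed.

(** Right multiplication by a positive element is extended linearly to a right factor of any
    sign. *)
Definition tensor_mul (u t : T) : T := cone_ext (fun s => tensor_rmul s u) t.

Lemma tensor_mul_bilinear : bilinear_map tensor_mul.
Proof.
split=> [t|u]; last first.
  apply: cone_ext_linear => [s t s0 t0|c t c0 t0]; first exact: tensor_rmulD.
  exact: tensor_rmulZ.
move=> c u v; rewrite /tensor_mul /cone_ext.
rewrite !(tensor_rmul_hom _).1 ?pos_ge0 ?neg_ge0 //.
by rewrite opprD addrACA scalerBr.
Qed.

Lemma tensor_mul_homl t : 0 <= t -> riesz_hom (tensor_mul^~ t).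
Proof.
move=> t0; suff -> : tensor_mul^~ t = tensor_rmul t by apply: tensor_rmul_hom.
by apply/funext => u; apply: cone_ext_id => // *; apply: tensor_rmulD.
Qed.

Lemma tensor_mul_tensl a b t : 0 <= a -> 0 <= b -> tensor_mul (tens a b) t = tensor_lmul a b t.
Proof.
move=> a0 b0; rewrite /tensor_mul /cone_ext !tensor_rmulE ?pos_ge0 ?neg_ge0 //.
rewrite !tensor_lmul_extE // -(linear_B (tensor_lmul_hom a0 b0).1) posBneg //.
Qed.

Lemma tensor_mul_tens a b x y :
  tensor_mul (tens a b) (tens x y) = tens (mulA a x) (mulB b y).
Proof.
have [mull _] := tensor_mul_bilinear.
have E a' b' : 0 <= a' -> 0 <= b' ->
    tensor_mul (tens a' b') (tens x y) = tens (mulA a' x) (mulB b' y).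
  by move=> a'0 b'0; rewrite tensor_mul_tensl // tensor_lmulE.
rewrite -(posBneg a) -(posBneg b) (linear_B (mulA_bil.1 x)) (linear_B (mulB_bil.1 y)).
rewrite !(linear_B (bimorphism_linl bimT _)) !(linear_B (bimorphism_linr bimT _)).
rewrite !(linear_B (mull _)) !E ?pos_ge0 ?neg_ge0 //.
Qed.

Lemma tensor_mul_extends : extends_canonical_product mulA mulB tens tensor_mul.
Proof.
move=> s s'; have [mull mulr] := tensor_mul_bilinear.
rewrite (linear_bigsum (mull _)); apply: eq_bigr => p _.
by rewrite (linear_bigsum (mulr _)); apply: eq_bigr => q _; rewrite tensor_mul_tens.
Qed.

(** Both sides are compared as Riesz homomorphisms in one variable at a time: first for two positive
    tensors on the left, then for [v] arbitrary, then for [u] arbitrary. Positivity of the factors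
    to the right is removed last, by bilinearity. *)
Lemma tensor_mul_assoc : associative tensor_mul.
Proof.
have [mull mulr] := tensor_mul_bilinear.
have mulP a b : 0 <= a -> 0 <= b -> 0 <= mulA a b by apply: loa_mul_ge0 (falg_loa fA) _ _.
have mulPB a b : 0 <= a -> 0 <= b -> 0 <= mulB a b by apply: loa_mul_ge0 (falg_loa fB) _ _.
have lmul_comp a b c d w : 0 <= a -> 0 <= b -> 0 <= c -> 0 <= d ->
    tensor_lmul a b (tensor_lmul c d w) = tensor_lmul (mulA a c) (mulB b d) w.
  move=> a0 b0 c0 d0; have [ac0 bd0] := (mulP a c a0 c0, mulPB b d b0 d0); move: w.
  apply: (riesz_tensor_hom_eq_ge0 tensP); last first.
  - move=> x y x0 y0; rewrite !tensor_lmulE //.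
    by rewrite (loa_assoc (falg_loa fA)) (loa_assoc (falg_loa fB)).
  - exact: tensor_lmul_hom.
  by apply: riesz_hom_comp; apply: tensor_lmul_hom.
have lmul_mul a b v w : 0 <= a -> 0 <= b -> 0 <= w ->
    tensor_lmul a b (tensor_mul v w) = tensor_mul (tensor_lmul a b v) w.
  move=> a0 b0 w0; have hw := tensor_mul_homl w0; have hab := tensor_lmul_hom a0 b0.
  move: v; apply: (riesz_tensor_hom_eq_ge0 tensP).
  - exact: riesz_hom_comp hab hw.
  - exact: riesz_hom_comp hw hab.
  move=> c d c0 d0; rewrite tensor_mul_tensl // lmul_comp // tensor_lmulE //.
  by rewrite tensor_mul_tensl // ?mulP ?mulPB.
have assoc_ge0 u v w : 0 <= v -> 0 <= w ->
    tensor_mul u (tensor_mul v w) = tensor_mul (tensor_mul u v) w.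
  move=> v0 w0; have hw := tensor_mul_homl w0; have hv := tensor_mul_homl v0.
  have hvw := tensor_mul_homl (riesz_hom_ge0 hw v0).
  move: u; apply: (riesz_tensor_hom_eq_ge0 tensP hvw (riesz_hom_comp hw hv)) => a b a0 b0.
  by rewrite !tensor_mul_tensl // lmul_mul.
exact: bilinear_assoc_ge0 tensor_mul_bilinear assoc_ge0.
Qed.

Lemma tensor_mul_ge0 u t : 0 <= u -> 0 <= t -> 0 <= tensor_mul u t.
Proof. by move=> u0 t0; apply: (riesz_hom_ge0 (tensor_mul_homl t0)). Qed.

(** A positive [h] lies below some [tens x y]. Multiplication by [tens x y] on either side is an
    orthomorphism, as it is induced by multiplications by [x] and [y], and it dominates
    multiplication by [h]. *)
Lemma tensor_mul_falg : f_algebra tensor_mul.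
Proof.
have [mull mulr] := tensor_mul_bilinear.
split; first by split; [exact: tensor_mul_assoc | exact: tensor_mul_bilinear | exact: tensor_mul_ge0].
move=> f g h fg h0; have [f0 g0] := disjoint_ge0 fg.
have [x [y [x0 y0 hxy]]] := riesz_tensor_le tensP h.
have {}hxy : h <= tens x y by apply: le_trans hxy; apply: le_abs.
have xy0 := bimorphism_ge0 bimT x0 y0.
have dxy : 0 <= tens x y - h by rewrite riesz_subr_ge0.
split.
- have [_ orth] := tensor_orthomorphism tensP (falg_mulr_orthomorphism fA x0)
    (falg_mulr_orthomorphism fB y0) (tensor_mul_homl xy0)
    (fun a b _ _ => tensor_mul_tens a b x y).
  apply: (disjoint_le (orth f g fg)) => //; first exact: tensor_mul_ge0.
  by rewrite -riesz_subr_ge0 -(linear_B (mulr _)) tensor_mul_ge0.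
have [_ orth] := tensor_orthomorphism tensP (falg_mull_orthomorphism fA x0)
  (falg_mull_orthomorphism fB y0) (tensor_lmul_hom x0 y0)
  (fun a b _ _ => tensor_lmulE a b x0 y0).
apply: (disjoint_le (orth f g fg)) => //; first exact: tensor_mul_ge0.
by rewrite -tensor_mul_tensl // -riesz_subr_ge0 -(linear_B (mull _)) tensor_mul_ge0.
Qed.

End TensorProduct.

(** * The extended product and its multiplicative universal property *)

Theorem theorem5p5 (R : realType) (A B : rieszType R)
    (mulA : A -> A -> A) (mulB : B -> B -> B)
    (archA : archimedean A) (archB : archimedean B)
    (fA : f_algebra mulA) (fB : f_algebra mulB)
    (semiprimeA : semiprime mulA) (semiprimeB : semiprime mulB)
    (T : rieszType R) (tens : A -> B -> T)
    (tensP : riesz_tensor_product tens) :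
  exists mulT : T -> T -> T,
    [/\ f_algebra mulT,
        extends_canonical_product mulA mulB tens mulT
      & forall (C : rieszType R) (mulC : C -> C -> C) (psi : A -> B -> C),
          archimedean C -> f_algebra mulC ->
          riesz_bimorphism psi -> bimultiplicative mulA mulB mulC psi ->
          exists! psiT : T -> C,
            [/\ algebra_hom mulT mulC psiT, riesz_hom psiT
              & forall (f : A) (g : B), psiT (tens f g) = psi f g]].
Proof.
exists (tensor_mul mulA mulB tens); split.
- exact: tensor_mul_falg.
- exact: tensor_mul_extends.
move=> C mulC psi archC fC psiP psiM.
have [h [[h_hom hE] h_uniq]] := rtp_universal tensP archC psiP.
(* Uniqueness already holds among Riesz homomorphisms, so what remains is that [h] is
   multiplicative. *)
exists h; split; last by move=> h' [_ h'_hom h'E]; apply: h_uniq.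
split=> //; split; first by case: h_hom.
have [mull mulr] := tensor_mul_bilinear fA fB tensP.
have [mulCl mulCr] := loa_bilinear (falg_loa fC).
have h_lin := h_hom.1.
(* Multiplication by a positive element of [C] is a Riesz homomorphism, so both sides need comparing
   on positive tensors only: first in the right factor, then in the left one. *)
have lmul_mult a b t : 0 <= a -> 0 <= b ->
    h (tensor_lmul mulA mulB tens a b t) = mulC (psi a b) (h t).
  move=> a0 b0; have ab0 := bimorphism_ge0 psiP a0 b0; move: t.
  apply: (riesz_tensor_hom_eq_ge0 tensP).
  - exact: riesz_hom_comp h_hom (tensor_lmul_hom fA fB tensP a0 b0).
  - apply: riesz_hom_comp h_hom.
    exact: orthomorphism_hom (falg_mull_orthomorphism fC ab0).
  by move=> x y x0 y0; rewrite (tensor_lmulE fA fB tensP) // !hE psiM.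
have mult_ge0 u t : 0 <= t -> h (tensor_mul mulA mulB tens u t) = mulC (h u) (h t).
  move=> t0; have ht0 := riesz_hom_ge0 h_hom t0; move: u.
  apply: (riesz_tensor_hom_eq_ge0 tensP).
  - exact: riesz_hom_comp h_hom (tensor_mul_homl fA fB tensP t0).
  - apply: (riesz_hom_comp (f := mulC^~ (h t))) h_hom.
    exact: orthomorphism_hom (falg_mulr_orthomorphism fC ht0).
  by move=> a b a0 b0; rewrite (tensor_mul_tensl fA fB tensP) // hE lmul_mult.
move=> u t; rewrite -{1}(posBneg t) (linear_B (mulr u)) [LHS](linear_B h_lin).
rewrite !mult_ge0 ?pos_ge0 ?neg_ge0 //.
by rewrite -(linear_B (mulCr _)) -(linear_B h_lin) posBneg.
Qed.
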